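(* Let $\eta>0$, $n\in\mathbb N$, $q,q'\in B_\rho(q^0,\eta)$ and $x_1,\ldots,x_m\in\mathcal S(\mathcal R)$. Then $$p_n(x_1\cdot_q\cdots\cdot_qx_m)\le\prod_{i=1}^mC_\eta C_b\,p_{n+b'}(x_i),$$ $$p_n\big(x_1\cdot_q\cdots\cdot_qx_m-x_1\cdot_{q'}\cdots\cdot_{q'}x_m\big)\le\rho(q,q')\prod_{i=1}^mC_\eta C_b\,p_{n+b'}(x_i).$$
   Context: $\mathcal R=(X,Y,R_0,R_0^\vee,F_0)$ is a reduced based root datum: $X,Y$ free abelian groups of the same finite rank with a perfect pairing $\langle\cdot,\cdot\rangle$; $R_0\subset X$, $R_0^\vee\subset Y$ finite with a bijection $\alpha\mapsto\alpha^\vee$ such that $\langle\alpha,\alpha^\vee\rangle=2$, $s_\alpha(x)=x-\langle x,\alpha^\vee\rangle\alpha$ preserves $R_0$, the dual reflections preserve $R_0^\vee$, and $\mathbb Z\alpha\cap R_0=\{\pm\alpha\}$; $F_0$ a basis of simple roots; $R_0^\pm$ the positive/negative roots. $W_0=\langle s_\alpha\rangle$, $Q=\mathbb ZR_0$, $W=X\rtimes W_0$ acting on $X$ by affine maps, $t_x$ translation by $x$. Length: $\ell(wt_x)=\sum_{\alpha\in R_0^+\cap w^{-1}(R_0^-)}|\langle x,\alpha^\vee\rangle+1|+\sum_{\alpha\in R_0^+\cap w^{-1}(R_0^+)}|\langle x,\alpha^\vee\rangle|$ for $w\in W_0$, $x\in X$. $S_{\rm aff}=\{s_\alpha:\alpha\in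 F_0\}\cup\{t_\alpha s_\alpha:\alpha^\vee$ the highest coroot of an irreducible component of $R_0^\vee\}$. $L_{\mathcal R}$ is the set of positive label functions $q:W\to(0,\infty)$, i.e. $q(\omega)=1$ if $\ell(\omega)=0$ and $q(wv)=q(w)q(v)$ if $\ell(wv)=\ell(w)+\ell(v)$; $q^0\equiv1$. For $s_i\in S_{\rm aff}$ put $\eta_i=q(s_i)^{1/2}-q(s_i)^{-1/2}$ (and $\eta_i'$ for $q'$); $\rho(q,q')=\max_{s_i\in S_{\rm aff}}|\eta_i-\eta_i'|$ is a metric on $L_{\mathcal R}$ and $B_\rho(q^0,\eta)$ is the ball of radius $\eta$ around $q^0$. $\mathcal H(\mathcal R,q)$ has basis $T_w$, $T_wT_v=T_{wv}$ if lengths add, $T_s^2=(q(s)-1)T_s+q(s)T_e$ for $s\in S_{\rm aff}$; $N_w=q(w)^{-1/2}T_w$. Let $f:X\otimes\mathbb R\to[0,\infty)$ be $Q\otimes\mathbb R$-invariant, $f(X)\subset\mathbb Z$, inducing a norm on $(X\otimes\mathbb R)/(Q\otimes\mathbb R)$; $\mathcal N(w)=\ell(w)+f(w(0))$. $\mathcal S(\mathcal R,q)$ is the completion of $\mathcal H(\mathcal R,q)$ for the norms $p_n(\sum x_wN_w)=\sup_w|x_w|(\mathcal N(w)+1)^n$; it is a Fréchet algebra. Via the bases $N_w$ all these Fréchet spaces are identified with one space $\mathcal S(\mathcal R)$, on which $\cdot_q$ denotes the product of $\mathcal S(\mathcal R,q)$. Constants: $b=\mathrm{rk}(X)+1$,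 $C_b=\sum_{w\in W}(\mathcal N(w)+1)^{-b}<\infty$, $C_\eta=3C_b\max\{1,\eta^{|R_0^+|}\}$, $b'=2b+|R_0^+|$. *)

(* Defs.v *)
From HB Require Import structures.
From mathcomp Require Import all_boot all_order all_algebra finmap complex.
From mathcomp Require Import all_classical all_reals all_analysis.

Set Implicit Arguments.
Unset Strict Implicit.
Unset Printing Implicit Defensive.

Import Order.TTheory GRing.Theory Num.Theory.
Import numFieldNormedType.Exports.

Local Open Scope classical_set_scope.
Local Open Scope ring_scope.

(* Bases of X and Y are chosen, so that X = Y = Z^r as groups (column vectors); *)
(* the perfect pairing stays arbitrary.                                         *)

Definition nonneg_comb (r : nat) (F : seq 'cV[int]_r) (v : 'cV[int]_r) : Prop :=
  exists c : 'cV[int]_r -> nat, v = \sum_(a <- F) a *+ c a.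

Record based_root_datum (r : nat) := BasedRootDatum {
  pairing : 'cV[int]_r -> 'cV[int]_r -> int;
  R0 : {fset 'cV[int]_r};
  coroot : 'cV[int]_r -> 'cV[int]_r;
  F0 : {fset 'cV[int]_r};
  pairingDl : forall x x' y, pairing (x + x') y = pairing x y + pairing x' y;
  pairingDr : forall x y y', pairing x (y + y') = pairing x y + pairing x y';
  perfectl : forall phi : 'cV[int]_r -> int, {morph phi : x x' / x + x'} ->
    exists! y, forall x, pairing x y = phi x;
  perfectr : forall phi : 'cV[int]_r -> int, {morph phi : y y' / y + y'} ->
    exists! x, forall y, pairing x y = phi y;
  coroot_inj : {in R0 &, injective coroot};
  pairing_coroot : {in R0, forall a, pairing a (coroot a) = 2};
  refl_roots : {in R0 &, forall a b,
    b - a *~ pairing b (coroot a) \in R0};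
  refl_coroots : {in R0 &, forall a b,
    coroot b - coroot a *~ pairing a (coroot b) \in map coroot R0};
  reduced : {in R0, forall a b,
    (b \in R0 /\ exists k : int, b = a *~ k) <-> (b = a \/ b = - a)};
  simple_roots : {subset F0 <= R0};
  simple_free : forall c : 'cV[int]_r -> int,
    \sum_(a <- F0) a *~ c a = 0 -> {in F0, forall a, c a = 0};
  simple_basis : {in R0, forall a,
    nonneg_comb F0 a \/ nonneg_comb F0 (- a)}
}.

Section WeylGroup.
Variables (r : nat) (D : based_root_datum r).

Definition pos_roots : seq 'cV[int]_r :=
  [seq a <- R0 D | `[< nonneg_comb (F0 D) a >]].

Definition neg_roots : seq 'cV[int]_r := [seq - a | a <- pos_roots].

Definition coroots : seq 'cV[int]_r := map (coroot D) (R0 D).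

Definition simple_coroots : seq 'cV[int]_r := map (coroot D) (F0 D).

Definition refl (a x : 'cV[int]_r) : 'cV[int]_r :=
  x - a *~ pairing D x (coroot D a).

Definition refl_mx (a : 'cV[int]_r) : 'M[int]_r :=
  \matrix_(i, j) refl a (delta_mx j 0) i 0.

(* No closure under inverses is needed: each reflection is an involution. *)
Inductive in_weyl : 'M[int]_r -> Prop :=
| in_weyl1 : in_weyl 1%:M
| in_weylM a A : a \in R0 D -> in_weyl A -> in_weyl (refl_mx a *m A).

Definition weyl : choiceType := {A : 'M[int]_r | `[< in_weyl A >]}.

Lemma refl_mxE a x : refl_mx a *m x = refl a x.
Proof.
pose g y := pairing D y (coroot D a).
have g0 : g 0 = 0.
  by apply: (addrI (g 0)); rewrite -[LHS]pairingDl !addr0.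
have gN y : g (- y) = - g y.
  by apply/eqP; rewrite -addr_eq0 -[_ + _]pairingDl addNr; apply/eqP.
have gn y k : g (y *+ k) = g y *+ k.
  by elim: k => [|k IH]; rewrite ?mulr0n// !mulrS -IH -[RHS]pairingDl.
have gz y k : g (y *~ k) = g y *~ k.
  by case: k => k; [exact: gn | rewrite !NegzE !mulrNz gN -!pmulrn gn].
have gs s (F : 'I_r -> 'cV[int]_r) :
    g (\sum_(j <- s) F j) = \sum_(j <- s) g (F j).
  by elim: s => [|j s IH]; rewrite ?big_nil// !big_cons -IH -[RHS]pairingDl.
have xE : x = \sum_j delta_mx j 0 *~ x j 0.
  apply/colP => i; rewrite summxE (bigD1 i)//= big1 => [|j ji].
    by rewrite addr0 -scaler_int !mxE !eqxx/= mulr1 intz.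
  by rewrite -scaler_int !mxE eq_sym (negbTE ji) mulr0.
have -> : refl a x = \sum_j refl a (delta_mx j 0) *~ x j 0.
  rewrite [in LHS]xE /refl -/(g _) gs mulrz_sumr -sumrB.
  by apply: eq_bigr => j _; rewrite gz mulrzBl mulrzz mulrzA.
apply/colP => i; rewrite !mxE summxE; apply: eq_bigr => j _.
by rewrite -scaler_int intz [RHS]mxE mulrC !mxE.
Qed.

Lemma in_weyl_mul A B : in_weyl A -> in_weyl B -> in_weyl (A *m B).
Proof.
move=> hA hB; elim: hA => [|a A' aR _ IH]; first by rewrite mul1mx.
by rewrite -mulmxA; apply: in_weylM.
Qed.

Lemma in_weyl_refl a : a \in R0 D -> in_weyl (refl_mx a).
Proof. by move=> aR; rewrite -[refl_mx a]mulmx1; exact/in_weylM/in_weyl1. Qed.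

Definition weyl_one : weyl := exist _ 1%:M (asboolT in_weyl1).

Definition weyl_mul (u v : weyl) : weyl :=
  exist _ (val u *m val v)
    (asboolT (in_weyl_mul (asboolW (valP u)) (asboolW (valP v)))).

Definition weyl_refl (a : R0 D) : weyl :=
  exist _ (refl_mx (val a)) (asboolT (in_weyl_refl (valP a))).

(* (x, w) stands for t_x w, i.e. the affine map z |-> x + w z. *)
Definition affweyl : choiceType := ('cV[int]_r * weyl)%type.

Definition aff_one : affweyl := (0, weyl_one).

Definition aff_mul (g h : affweyl) : affweyl :=
  (g.1 + val g.2 *m h.1, weyl_mul g.2 h.2).

Definition aff_act (g : affweyl) (z : 'cV[int]_r) : 'cV[int]_r :=
  g.1 + val g.2 *m z.

(* The length formula is for w t_x, and t_y w = w t_x with x = w^-1 y. *)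
Definition len (g : affweyl) : nat :=
  let w := val g.2 in let x := invmx w *m g.1 in
  (\sum_(a <- pos_roots | w *m a \in neg_roots)
      `|(pairing D x (coroot D a) + 1)%R|
   + \sum_(a <- pos_roots | w *m a \in pos_roots)
      `|pairing D x (coroot D a)|)%N.

Definition orthogonal_part (C : {fset 'cV[int]_r}) : Prop :=
  {subset C <= coroots} /\
  {in R0 D &, forall a b, coroot D a \in C -> coroot D b \notin C ->
     pairing D a (coroot D b) = 0}.

Definition irreducible_component (C : {fset 'cV[int]_r}) : Prop :=
  [/\ C != fset0, orthogonal_part C &
      forall C' : {fset 'cV[int]_r}, C' != fset0 -> {subset C' <= C} ->
        orthogonal_part C' -> C' = C].

Definition highest_coroot (b : 'cV[int]_r) : Prop :=
  exists C : {fset 'cV[int]_r}, [/\ irreducible_component C, b \in C &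
    {in C, forall c, nonneg_comb simple_coroots (b - c)}].

Definition Saff : seq affweyl :=
  [seq (0, weyl_refl a) | a <- enum {: R0 D} & val a \in F0 D] ++
  [seq (val a, weyl_refl a) | a <- enum {: R0 D} &
     `[< highest_coroot (coroot D (val a)) >]].

End WeylGroup.

Section Labels.
Variables (R : realType) (r : nat) (D : based_root_datum r).
Implicit Types q : affweyl D -> R.

Definition is_label q : Prop :=
  [/\ forall w, 0 < q w,
      forall w, len w = 0%N -> q w = 1 &
      forall w v, len (aff_mul w v) = (len w + len v)%N ->
        q (aff_mul w v) = q w * q v].

Definition label0 : affweyl D -> R := fun=> 1.

Definition eta_label q (s : affweyl D) : R :=
  Num.sqrt (q s) - (Num.sqrt (q s))^-1.

Definition rho q q' : R :=
  \big[Num.max/0]_(s <- Saff D) `|eta_label q s - eta_label q' s|.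

Definition rho_ball q (eps : R) : set (affweyl D -> R) :=
  [set q' | is_label q' /\ rho q q' < eps].

End Labels.

Section Schwartz.
Variables (R : realType) (r : nat) (D : based_root_datum r).

Definition to_real (x : 'cV[int]_r) : 'cV[R]_r := map_mx intr x.

Definition in_QR (y : 'cV[R]_r) : Prop :=
  exists c : 'cV[int]_r -> R, y = \sum_(a <- R0 D) c a *: to_real a.

(* A QR-invariant f induces a norm on the quotient by QR iff it is a seminorm *)
(* vanishing only on QR.                                                      *)
Definition is_central_norm (f : 'cV[R]_r -> R) : Prop :=
  [/\ forall x, 0 <= f x,
      forall x y, in_QR y -> f (x + y) = f x,
      forall x : 'cV[int]_r, f (to_real x) \in Num.int &
      [/\ forall x y, f (x + y) <= f x + f y,
          forall c x, f (c *: x) = `|c| * f x &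
          forall x, f x = 0 -> in_QR x]].

Variable f : 'cV[R]_r -> R.

Definition calN (w : affweyl D) : R := (len w)%:R + f (to_real (aff_act w 0)).

(* x stands for the formal sum of the x_w N_w; in these coordinates the     *)
(* underlying space of S(R, q) does not depend on q.                        *)
Definition hseries : Type := affweyl D -> R[i].
HB.instance Definition _ := GRing.Zmodule.on hseries.

Definition pnorm (n : nat) (x : hseries) : \bar R :=
  ereal_sup [set (Normc.normc (x w) * (calN w + 1) ^+ n)%:E
            | w in [set: affweyl D]].

Definition finsupp (x : hseries) : Prop := finite_set [set w | x w != 0].

Definition scvg (y : nat -> hseries) (x : hseries) : Prop :=
  forall n, pnorm n (x - y k) @[k --> \oo] --> 0%E.

(* Each p_n-Cauchy sequence of finitely supported series (all n at once)    *)
(* converges to a series, so the completion is this closure.                *)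
Definition schwartz (x : hseries) : Prop :=
  exists y : nat -> hseries, (forall k, finsupp (y k)) /\ scvg y x.

Definition hscale (c : R[i]) (x : hseries) : hseries := fun w => c * x w.

Definition Nbasis (w : affweyl D) : hseries := fun v => (v == w)%:R.

Definition Tbasis (q : affweyl D -> R) (w : affweyl D) : hseries :=
  hscale (Num.sqrt (q w))%:C%C (Nbasis w).

(* The product of H(R, q), as a product on finitely supported series; the *)
(* values of mul elsewhere are irrelevant.                                *)
Record is_hecke_mul (q : affweyl D -> R) (mul : hseries -> hseries -> hseries)
  : Prop := IsHeckeMul {
  hecke_fin : forall x y, finsupp x -> finsupp y -> finsupp (mul x y);
  hecke_linl : forall c x x' y, finsupp x -> finsupp x' -> finsupp y ->
    mul (hscale c x + x') y = hscale c (mul x y) + mul x' y;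
  hecke_linr : forall c x y y', finsupp x -> finsupp y -> finsupp y' ->
    mul x (hscale c y + y') = hscale c (mul x y) + mul x y';
  heckeA : forall x y z, finsupp x -> finsupp y -> finsupp z ->
    mul x (mul y z) = mul (mul x y) z;
  hecke_mulT : forall w v, len (aff_mul w v) = (len w + len v)%N ->
    mul (Tbasis q w) (Tbasis q v) = Tbasis q (aff_mul w v);
  hecke_quad : forall s, s \in Saff D ->
    mul (Tbasis q s) (Tbasis q s) =
      hscale (q s - 1)%:C%C (Tbasis q s) +
      hscale (q s)%:C%C (Tbasis q (aff_one D))
}.

(* The extension of mul by continuity: for a Hecke product mul and Schwartz  *)
(* x, y there is exactly one such z, so the default value 0 is never used.   *)
Definition schwartz_mul (mul : hseries -> hseries -> hseries) (x y : hseries)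
  : hseries :=
  xget 0 [set z | schwartz z /\
    forall xk yk : nat -> hseries,
      (forall k, finsupp (xk k)) -> (forall k, finsupp (yk k)) ->
      scvg xk x -> scvg yk y -> scvg (fun k => mul (xk k) (yk k)) z].

Definition schwartz_prod (mul : hseries -> hseries -> hseries) (m : nat)
    (x : 'I_m.+1 -> hseries) : hseries :=
  foldl (schwartz_mul mul) (x ord0) [seq x (lift ord0 i) | i <- enum 'I_m].

Definition const_b : nat := r.+1.

Definition const_Cb : \bar R :=
  (\esum_(w in [set: affweyl D]) ((calN w + 1) ^- const_b)%:E)%E.

Definition const_Ceta (eta : R) : \bar R :=
  (3%:E * const_Cb * (Num.max 1 (eta ^+ size (pos_roots D)))%:E)%E.

Definition const_b' : nat := (2 * const_b + size (pos_roots D))%N.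

End Schwartz.

(* Main.v *)
Require Import Defs.
From HB Require Import structures.
From mathcomp Require Import all_boot all_order all_algebra finmap complex.
From mathcomp Require Import all_classical all_reals all_analysis.
From mathcomp Require Import zify ring lra.

(* For g in W and a root a let [sep g a] be the signed number of hyperplanes   *)
(* of direction a between the fundamental alcove and its image under g^-1.     *)
(* It is a cocycle in g, the length of g is the sum of [|sep g a|] over the    *)
(* positive roots, and {a | sep g a > 0} is closed. Expand N_u N_v along a     *)
(* reduced word of v. Each use of the quadratic relation (a fold) gives a      *)
(* factor eta_s and strictly decreases the number of roots a for which both    *)
(* [sep u a] and [sep v^-1 a] are positive, a number that never exceeds        *)
(* |R_0^+|; so each branch has at most |R_0^+| folds. With A = max(1, eta) to  *)
(* the power |R_0^+| and the weighted l^1 norms |x|_n, this gives              *)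
(*    |xy|_n <= A |x|_n |y|_(n + |R_0^+|)                                      *)
(* and the same bound, times rho(q, q'), for the difference of the products    *)
(* for q and q'. Only the right factor loses weight, so products associated    *)
(* to the left are estimated by induction, each factor of the difference at    *)
(* the price of a further factor 2 <= 3 C_b. Finally p_n <= |.|_n <= C_b       *)
(* p_(n + b).                                                                  *)

(** The combinatorial core is [folds_lt]: closedness of the roots with positive [sep] ([sep_closed])
    yields an injection between sets of crossed roots that misses one root, so a fold uses up one of
    at most |R_0^+| units ([folds_le_pos]). Reduced words come from [exchange]: an element of
    positive length crosses some wall of the fundamental alcove. Its proof needs the highest
    coroots, which describe the affine walls.

    The resulting bounds on N_u N_v ([Nmul_l1_le]) and on its variation with q ([Nmul_sub_l1_le])
    are polynomial in the length of v, of degree at most |R_0^+|; [bilinear_l1_le] charges this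
    polynomial to the weight of the right factor. When C_b is finite, density of the finitely
    supported series carries the bounds to the Schwartz space, where [foldl_schwartz_mul] and
    [foldl_schwartz_mul_sub] iterate them. *)

Set Implicit Arguments.
Unset Strict Implicit.
Unset Printing Implicit Defensive.

Import Order.TTheory GRing.Theory Num.Theory.
Import numFieldNormedType.Exports.

(** * Based root data *)

Section NonnegComb.
Local Open Scope ring_scope.
Variable r : nat.
Implicit Types (F : seq 'cV[int]_r) (v w : 'cV[int]_r).

Lemma nonneg_comb0 F : nonneg_comb F 0.
Proof. by exists (fun=> 0%N); rewrite big1. Qed.

Lemma nonneg_combD F v w :
  nonneg_comb F v -> nonneg_comb F w -> nonneg_comb F (v + w).
Proof.
move=> [c ->] [d ->]; exists (fun a => c a + d a)%N.
by rewrite -big_split; apply: eq_bigr => a _; rewrite mulrnDr.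
Qed.

Lemma nonneg_combMn F v n : nonneg_comb F v -> nonneg_comb F (v *+ n).
Proof.
move=> [c ->]; exists (fun a => c a * n)%N.
by rewrite -sumrMnl; apply: eq_bigr => a _; rewrite mulrnA.
Qed.

Lemma nonneg_comb_mem F v : uniq F -> v \in F -> nonneg_comb F v.
Proof.
move=> uF vF; exists (fun a => a == v : nat).
rewrite (bigD1_seq v)//= eqxx big1 ?addr0// => a /negbTE ->//.
Qed.

End NonnegComb.

Section Roots.
Local Open Scope ring_scope.
Variables (r : nat) (D : based_root_datum r).
Implicit Types (a b c x y : 'cV[int]_r).

Local Notation pr x a := (pairing D x (coroot D a)).
Local Notation R0 := (R0 D).
Local Notation F0 := (F0 D).
Local Notation refl := (refl D).
Local Notation pos := (pos_roots D).

Let morphB (U V : zmodType) (g : U -> V) :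
  {morph g : x y / x + y} -> zmod_morphism g.
Proof. by move=> gD x y; apply: (addIr (g y)); rewrite -gD !subrK. Qed.

Let pairl y x := pairing D x y.
HB.instance Definition _ y := GRing.isZmodMorphism.Build _ _ (pairl y)
  (morphB (fun x x' => pairingDl D x x' y)).
HB.instance Definition _ x := GRing.isZmodMorphism.Build _ _ (pairing D x)
  (morphB (pairingDr D x)).

Lemma pairing0l y : pairing D 0 y = 0.
Proof. exact: (raddf0 (pairl y)). Qed.

Lemma pairingNl x y : pairing D (- x) y = - pairing D x y.
Proof. exact: (raddfN (pairl y)). Qed.

Lemma pairingBl x x' y : pairing D (x - x') y = pairing D x y - pairing D x' y.
Proof. exact: (raddfB (pairl y)). Qed.

Lemma pairingZl x k y : pairing D (x *~ k) y = pairing D x y * k.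
Proof. by rewrite -[LHS]/(pairl y _) raddfMz mulrzz. Qed.

Lemma pairing_suml (I : Type) (s : seq I) (P : pred I) F y :
  pairing D (\sum_(i <- s | P i) F i) y = \sum_(i <- s | P i) pairing D (F i) y.
Proof. exact: (raddf_sum (pairl y)). Qed.

Lemma pairingNr x y : pairing D x (- y) = - pairing D x y.
Proof. exact: raddfN. Qed.

Lemma pairingBr x y y' : pairing D x (y - y') = pairing D x y - pairing D x y'.
Proof. exact: raddfB. Qed.

Lemma pairingZr x k y : pairing D x (y *~ k) = pairing D x y * k.
Proof. by rewrite raddfMz mulrzz. Qed.

Lemma pairing_sumr (I : Type) (s : seq I) (P : pred I) F x :
  pairing D x (\sum_(i <- s | P i) F i) = \sum_(i <- s | P i) pairing D x (F i).
Proof. exact: raddf_sum. Qed.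

Lemma cV_mulz_eq0 x (k : int) : x *~ k = 0 -> k != 0 -> x = 0.
Proof.
move=> xk k0; apply/colP => i; have /colP/(_ i) := xk.
by rewrite -scaler_int intz !mxE => /eqP; rewrite mulf_eq0 (negbTE k0)/= => /eqP.
Qed.

Lemma reflB a x y : refl a (x - y) = refl a x - refl a y.
Proof.
by rewrite /Defs.refl pairingBl mulrzBr !opprD !opprK addrACA.
Qed.

Lemma reflMz a x k : refl a (x *~ k) = refl a x *~ k.
Proof. by rewrite /Defs.refl pairingZl mulrzBl mulrzA. Qed.

Lemma refl_root a b : a \in R0 -> b \in R0 -> refl a b \in R0.
Proof. exact: refl_roots. Qed.

Lemma refl_self a : a \in R0 -> refl a a = - a.
Proof.
by move=> aR; rewrite /Defs.refl pairing_coroot// -[_ *~ 2]/(_ *+ 2) mulr2n opprD addNKr.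
Qed.

Lemma pr_refl_self a x : a \in R0 -> pr (refl a x) a = - pr x a.
Proof.
move=> aR; rewrite /Defs.refl pairingBl pairingZl pairing_coroot//; lia.
Qed.

Lemma reflK a : a \in R0 -> involutive (refl a).
Proof.
move=> aR x; rewrite {1}/Defs.refl pr_refl_self// mulrNz opprK.
by rewrite /Defs.refl subrK.
Qed.

Lemma refl_inj a : a \in R0 -> injective (refl a).
Proof. by move=> /reflK; apply: inv_inj. Qed.

Lemma oppR a : (- a \in R0) = (a \in R0).
Proof.
have H b : b \in R0 -> - b \in R0.
  by move=> bR; rewrite -refl_self// refl_root.
by apply/idP/idP => [/H|/H//]; rewrite opprK.
Qed.

Lemma root_neq0 a : a \in R0 -> a != 0.
Proof.
by apply: contraTneq => ->; apply/negP => /pairing_coroot; rewrite pairing0l.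
Qed.

Lemma coroot_neq0 a : a \in R0 -> coroot D a != 0.
Proof.
by move=> aR; apply/eqP => e; have := pairing_coroot aR; rewrite e raddf0.
Qed.

(** Pigeonhole: with x nonzero these would be more distinct roots than the finite set R_0 has. *)
Lemma root_line_eq0 a x : (forall k : nat, a + x *+ k \in R0) -> x = 0.
Proof.
move=> H; apply/eqP/negPn/negP => x0.
pose s := [seq a + x *+ k | k <- iota 0 (size R0).+1].
have us : uniq s.
  rewrite map_inj_uniq ?iota_uniq// => i j /addrI e.
  apply/eqP/negPn/negP => ij; move/eqP: x0; apply.
  apply: (@cV_mulz_eq0 _ (i%:Z - j%:Z)); last by rewrite subr_eq0 eqz_nat.
  by rewrite mulrzBr -!pmulrn e subrr.
have sR : {subset s <= R0} by move=> _ /mapP[k _ ->].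
by have := uniq_leq_size us sR; rewrite size_map size_iota ltnn.
Qed.

(* s_a s_b translates the line through a and b by 2 (a - b). *)
Lemma root_eq a b : a \in R0 -> b \in R0 -> pr a b = 2 -> pr b a = 2 -> a = b.
Proof.
move=> aR bR ab ba; apply/eqP; rewrite -subr_eq0; apply/eqP.
apply: (@cV_mulz_eq0 _ 2) => //; apply: (@root_line_eq0 a) => k.
elim: k => [|k IH]; first by rewrite mulr0n addr0.
suff -> : a + (a - b) *~ 2 *+ k.+1 = refl a (refl b (a + (a - b) *~ 2 *+ k)).
  by rewrite !refl_root.
set y := a + _ *+ k.
have yb : pr y b = 2.
  rewrite /y pmulrn pairingDl !pairingZl pairingBl ab pairing_coroot//; ring.
have ya : pr y a = 2.
  rewrite /y pmulrn pairingDl !pairingZl pairingBl ba pairing_coroot//; ring.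
rewrite {2}/Defs.refl yb /Defs.refl pairingBl ya pairingZl ba mulrSr addrA -/y.
rewrite -!scaler_int !intz.
by apply/colP => i; rewrite !mxE; ring.
Qed.

(** The datum only says that the reflected coroot is the coroot of some root c. The pairing with c
    is that of s_a x with b; comparing c with d = s_a b on all roots and applying [root_eq] gives c
    = d. *)
Lemma coroot_refl a b : a \in R0 -> b \in R0 ->
  coroot D (refl a b) = coroot D b - coroot D a *~ pairing D a (coroot D b).
Proof.
move=> aR bR; have /mapP[c cR Ec] := refl_coroots aR bR.
have cE x : pr x c = pr (refl a x) b.
  by rewrite -Ec /Defs.refl !(pairingBl, pairingBr, pairingZl, pairingZr); ring.
set d := refl a b; have dR : d \in R0 by apply: refl_root.
have dc : pr d c = 2 by rewrite cE reflK// pairing_coroot.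
have agree x : x \in R0 -> pr x d = pr x c.
  move=> xR; apply/eqP; rewrite -subr_eq0; apply/negPn/negP => nz.
  suff /cV_mulz_eq0/(_ nz) d0 : d *~ (pr x d - pr x c) = 0.
    by move: (root_neq0 dR); rewrite d0 eqxx.
  apply: (@root_line_eq0 x) => k; elim: k => [|k IH]; first by rewrite addr0.
  (* The product s_a s_b s_a s_d translates x along d by the discrepancy of the two pairings, and
     all iterates stay in R_0. *)
  suff -> : x + d *~ (pr x d - pr x c) *+ k.+1 =
     refl a (refl b (refl a (refl d (x + d *~ (pr x d - pr x c) *+ k)))).
    by rewrite !refl_root.
  set y := x + _ *+ k.
  have sab z : refl a (refl b (refl a z)) = z - d *~ pr z c.
    rewrite cE {2}/Defs.refl {1}/Defs.refl /d.
    by rewrite -/(Defs.refl D a _) reflB reflMz reflK.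
  have yd : pr y d = pr x d + 2 * (pr x d - pr x c) * k%:Z.
    by rewrite /y pairingDl pmulrn !pairingZl pairing_coroot//; ring.
  have yc : pr y c = pr x c + 2 * (pr x d - pr x c) * k%:Z.
    by rewrite /y pairingDl pmulrn !pairingZl dc; ring.
  have -> : refl d y = y - d *~ pr y d by [].
  rewrite sab pairingBl [pairing D (_ *~ _) _]pairingZl dc yd yc mulrSr addrA.
  rewrite -/y -!scaler_int !intz.
  by apply/colP => i; rewrite !mxE; ring.
suff -> : d = c by rewrite Ec.
by apply: root_eq => //; rewrite agree// pairing_coroot.
Qed.

Lemma corootN a : a \in R0 -> coroot D (- a) = - coroot D a.
Proof.
move=> aR; rewrite -refl_self// coroot_refl// pairing_coroot//.
by rewrite -[_ *~ 2]/(_ *+ 2) mulr2n opprD addNKr.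
Qed.

Lemma pr_refl a b x : a \in R0 -> b \in R0 -> pr (refl a x) (refl a b) = pr x b.
Proof.
move=> aR bR; rewrite coroot_refl// /Defs.refl.
by rewrite !(pairingBl, pairingBr, pairingZl, pairingZr) pairing_coroot//; ring.
Qed.

Lemma pr_reflr a b x : a \in R0 -> b \in R0 -> pr x (refl a b) = pr (refl a x) b.
Proof. by move=> aR bR; rewrite -{1}[x](reflK aR) pr_refl. Qed.

Lemma prN x a : a \in R0 -> pr x (- a) = - pr x a.
Proof. by move=> aR; rewrite corootN// pairingNr. Qed.

(** The canonical W_0-invariant, positive semidefinite form. It is symmetric, unlike the pairing of
    a root with a coroot, and decides the sign of the latter. *)
Definition rform x y : int := \sum_(c <- R0) pr x c * pr y c.

Lemma rformC x y : rform x y = rform y x.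
Proof. by apply: eq_bigr => c _; rewrite mulrC. Qed.

Lemma rformBl x x' y : rform (x - x') y = rform x y - rform x' y.
Proof. by rewrite -sumrB; apply: eq_bigr => c _; rewrite pairingBl mulrBl. Qed.

Lemma rformNl x y : rform (- x) y = - rform x y.
Proof. by rewrite -sumrN; apply: eq_bigr => c _; rewrite pairingNl mulNr. Qed.

Lemma rformZl x k y : rform (x *~ k) y = rform x y * k.
Proof. by rewrite mulr_suml; apply: eq_bigr => c _; rewrite pairingZl mulrAC. Qed.

Lemma rform_suml (I : Type) (s : seq I) (P : pred I) F y :
  rform (\sum_(i <- s | P i) F i) y = \sum_(i <- s | P i) rform (F i) y.
Proof.
rewrite /rform exchange_big; apply: eq_bigr => c _.
by rewrite pairing_suml mulr_suml.
Qed.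

Lemma rform_ge0 x : 0 <= rform x x.
Proof. by apply: sumr_ge0 => c _; rewrite -expr2 sqr_ge0. Qed.

Lemma rform_eq0 x : rform x x = 0 -> {in R0, forall c, pr x c = 0}.
Proof.
move=> /eqP; rewrite psumr_eq0 => [/allP H c /H|c _]; last by rewrite -expr2 sqr_ge0.
by rewrite /= mulf_eq0 orbb => /eqP.
Qed.

Lemma rform_gt0 a : a \in R0 -> 0 < rform a a.
Proof.
move=> aR; rewrite lt_neqAle rform_ge0 andbT eq_sym; apply/eqP => /rform_eq0/(_ a aR).
by rewrite pairing_coroot.
Qed.

Lemma perm_roots_refl a : a \in R0 -> perm_eq [seq refl a c | c <- R0] R0.
Proof.
move=> aR; apply: uniq_perm => [||c]; rewrite ?fset_uniq//.
  by rewrite map_inj_uniq ?fset_uniq//; apply: refl_inj.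
apply/mapP/idP => [[d dR ->]|cR]; first exact: refl_root.
by exists (refl a c); rewrite ?reflK// refl_root.
Qed.

Lemma rform_refl a x y : a \in R0 -> rform (refl a x) (refl a y) = rform x y.
Proof.
move=> aR; rewrite /rform -(perm_big _ (perm_roots_refl aR))/= big_map.
by apply: eq_big_seq => c cR; rewrite !pr_refl.
Qed.

(** Invariance of the form under s_a, which negates a. *)
Lemma rform_root x a : a \in R0 -> 2 * rform x a = rform a a * pr x a.
Proof.
move=> aR; have := rform_refl x a aR.
rewrite refl_self// {1}/Defs.refl rformBl rformZl rformC [rform a _]rformC !rformNl.
by rewrite [rform a x]rformC; lia.
Qed.

Lemma rform_pr_eq0 x a : a \in R0 -> (rform x a == 0) = (pr x a == 0).
Proof.
move=> aR; have e := rform_root x aR; have a0 := lt0r_neq0 (rform_gt0 aR).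
apply/eqP/eqP => h; move: e; rewrite h mulr0; last by move/eqP; rewrite mulf_eq0 => /eqP.
by move/esym/eqP; rewrite mulf_eq0 (negbTE a0) => /eqP.
Qed.

Lemma pr_gt0C a b : a \in R0 -> b \in R0 -> (0 < pr a b) = (0 < pr b a).
Proof.
move=> aR bR; have := rform_root a bR; have := rform_root b aR.
rewrite rformC; have := rform_gt0 aR; have := rform_gt0 bR; nia.
Qed.

Lemma pr_eq0C a b : a \in R0 -> b \in R0 -> (pr a b == 0) = (pr b a == 0).
Proof.
move=> aR bR; have := rform_root a bR; have := rform_root b aR.
rewrite rformC; have := rform_gt0 aR; have := rform_gt0 bR; nia.
Qed.

(** The equality case of Cauchy-Schwarz: the form is nonnegative at a - b, which forces both
    pairings down to 2. *)
Lemma pr_ge2_eq a b : a \in R0 -> b \in R0 -> 2 <= pr a b -> 2 <= pr b a -> a = b.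
Proof.
move=> aR bR ab ba; have eab := rform_root a bR; have eba := rform_root b aR.
have := rform_ge0 (a - b).
rewrite rformBl rformC rformBl [rform b (a - b)]rformC rformBl [rform b a]rformC.
rewrite rformC in eba.
move=> H.
have h1 := rform_gt0 aR; have h2 := rform_gt0 bR.
have e1 : rform b b * 2 <= rform b b * pr a b by rewrite ler_pM2l.
have e2 : rform a a * 2 <= rform a a * pr b a by rewrite ler_pM2l.
have /(mulfI (lt0r_neq0 h2)) p1 : rform b b * pr a b = rform b b * 2 by lia.
have /(mulfI (lt0r_neq0 h1)) p2 : rform a a * pr b a = rform a a * 2 by lia.
exact: root_eq.
Qed.

End Roots.

(** * Positive roots, positive coroots and heights *)

Section Positivity.
Local Open Scope ring_scope.
Variables (r : nat) (D : based_root_datum r).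
Implicit Types (a b c x y : 'cV[int]_r).

Local Notation pr x a := (pairing D x (coroot D a)).
Local Notation R0 := (R0 D).
Local Notation F0 := (F0 D).
Local Notation refl := (refl D).
Local Notation pos := (pos_roots D).

Lemma mem_pos a : (a \in pos) = (a \in R0) && `[< nonneg_comb F0 a >].
Proof. by rewrite mem_filter andbC. Qed.

Lemma posP a : reflect (a \in R0 /\ nonneg_comb F0 a) (a \in pos).
Proof. by rewrite mem_pos; apply: (iffP andP) => -[? /asboolP]. Qed.

Lemma pos_root a : a \in pos -> a \in R0.
Proof. by case/posP. Qed.

Lemma pos_uniq : uniq pos.
Proof. exact/filter_uniq/fset_uniq. Qed.

Lemma simple_root a : a \in F0 -> a \in R0.
Proof. exact: simple_roots. Qed.

Lemma simple_pos a : a \in F0 -> a \in pos.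
Proof.
move=> aF; apply/posP; split; first exact: simple_root.
exact/nonneg_comb_mem/aF/fset_uniq.
Qed.

Lemma nonneg_comb_antisym a :
  nonneg_comb F0 a -> nonneg_comb F0 (- a) -> a = 0.
Proof.
move=> [c ca] [d da].
have /simple_free H : \sum_(x <- F0) x *~ (c x + d x)%N%:Z = 0.
  under eq_bigr => x _ do rewrite -pmulrn mulrnDr.
  by rewrite big_split/= -ca -da subrr.
rewrite ca big_seq big1// => x /H /eqP.
by rewrite eqz_nat addn_eq0 => /andP[/eqP -> _].
Qed.

Lemma pos_oppN a : a \in pos -> - a \notin pos.
Proof.
case/posP => aR pa; apply/negP => /posP[_ /(nonneg_comb_antisym pa)] a0.
by move: (root_neq0 aR); rewrite a0 eqxx.
Qed.

Lemma opp_posE a : a \in R0 -> (- a \in pos) = (a \notin pos).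
Proof.
move=> aR; apply/idP/idP => [/pos_oppN|]; first by rewrite opprK.
have [pa|na] := simple_basis aR; first by move/negP; case; apply/posP.
by move=> _; apply/posP; rewrite oppR.
Qed.

(** s_b changes only the coefficient of b. If the result were negative, all other coefficients of a
    would vanish, so a would be a multiple of b, that is b or - b. *)
Lemma refl_simple_pos b a :
  b \in F0 -> a \in pos -> a != b -> refl b a \in pos.
Proof.
move=> bF aP ab; have bR := simple_root bF; have aR := pos_root aP.
apply/negPn/negP; rewrite -opp_posE ?refl_root// => /posP[_ [d dE]].
have [_ [c cE]] := posP _ aP.
have /simple_free H :
    \sum_(x <- F0) x *~ ((c x + d x)%N%:Z - (x == b)%:R * pr a b) = 0.
  under eq_bigr => x _ do rewrite mulrzBr -pmulrn mulrnDr.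
  rewrite sumrB big_split/= -cE -dE (bigD1_seq b)//= ?fset_uniq// eqxx mul1r.
  rewrite big1 => [|x /negbTE ->]; last by rewrite mul0r.
  by rewrite addr0 /Defs.refl opprB addrC subrK subrr.
have c0 x : x \in F0 -> x != b -> c x = 0%N.
  move=> /H + /negbTE xb; rewrite xb mul0r subr0 => /eqP.
  by rewrite eqz_nat addn_eq0 => /andP[/eqP].
have abk : a = b *~ (c b).
  rewrite cE (bigD1_seq b) ?fset_uniq//= big_seq_cond big1 ?addr0// => x /andP[xF xb].
  by rewrite c0.
have [] := (reduced bR a).1 (conj aR (ex_intro _ (c b : int) abk)).
  by move/eqP; rewrite (negbTE ab).
move=> aN; move: (pos_oppN aP); rewrite aN opprK.
by rewrite simple_pos.
Qed.

Lemma perm_refl_simple b : b \in F0 ->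
  perm_eq [seq refl b a | a <- pos & a != b] [seq a <- pos | a != b].
Proof.
move=> bF; have bR := simple_root bF; apply: uniq_perm => [||c].
- rewrite map_inj_uniq; first by rewrite filter_uniq ?pos_uniq.
  exact: refl_inj bR.
- by rewrite filter_uniq ?pos_uniq.
have H a : a \in pos -> a != b -> (refl b a != b) && (refl b a \in pos).
  move=> aP ab; rewrite refl_simple_pos// andbT.
  apply/eqP => /(congr1 (refl b)); rewrite reflK// refl_self// => aN.
  by move: (pos_oppN aP); rewrite aN opprK simple_pos.
rewrite mem_filter; apply/mapP/idP => [[a]|/andP[cb cP]].
  by rewrite mem_filter => /andP[ab aP] ->; rewrite H.
by exists (refl b c); rewrite ?reflK// mem_filter H.
Qed.

(** The usual 2 rho, left undivided to stay in X. Pairing with it ([ht]) is twice the height of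
    coroots; [coht] is twice the height of roots. *)
Definition rho2 := \sum_(a <- pos) a.
Definition ht y : int := pairing D rho2 y.
Definition coht x : int := \sum_(a <- pos) pr x a.

Lemma ht_simple b : b \in F0 -> ht (coroot D b) = 2.
Proof.
move=> bF; have bR := simple_root bF.
rewrite /ht pairing_suml (bigD1_seq b) ?pos_uniq ?simple_pos//= pairing_coroot//.
set S := \sum_(_ <- _ | _) _; suff : S = - S by lia.
rewrite {1}/S -big_filter -(perm_big _ (perm_refl_simple bF))/= big_map -sumrN.
rewrite big_filter big_seq_cond [RHS]big_seq_cond; apply: eq_bigr => a _.
exact: pr_refl_self.
Qed.

Lemma coht_simple b : b \in F0 -> coht b = 2.
Proof.
move=> bF; have bR := simple_root bF.
rewrite /coht (bigD1_seq b) ?pos_uniq ?simple_pos//= pairing_coroot//.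
set S := \sum_(_ <- _ | _) _; suff : S = - S by lia.
rewrite {1}/S -big_filter -(perm_big _ (perm_refl_simple bF))/= big_map -sumrN.
rewrite big_filter big_seq_cond [RHS]big_seq_cond.
apply: eq_bigr => a /andP[/pos_root aR _].
by rewrite pr_reflr// refl_self// pairingNl.
Qed.

Lemma cohtB x y : coht (x - y) = coht x - coht y.
Proof. by rewrite -sumrB; apply: eq_bigr => a _; rewrite pairingBl. Qed.

Lemma cohtZ x k : coht (x *~ k) = coht x * k.
Proof. by rewrite mulr_suml; apply: eq_bigr => a _; rewrite pairingZl. Qed.

Lemma coht_ge0 x : nonneg_comb F0 x -> 0 <= coht x.
Proof.
move=> [c ->]; rewrite /coht.
under eq_bigr => a _ do rewrite pairing_suml.
rewrite exchange_big/= big_seq; apply: sumr_ge0 => b bF.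
under eq_bigr => a _ do rewrite pmulrn pairingZl.
by rewrite -mulr_suml -/(coht b) coht_simple.
Qed.

Lemma htN x : ht (- x) = - ht x.
Proof. exact: pairingNr. Qed.
Lemma htB x y : ht (x - y) = ht x - ht y.
Proof. exact: pairingBr. Qed.
Lemma htZ x k : ht (x *~ k) = ht x * k.
Proof. exact: pairingZr. Qed.

(** The form is positive at (a, a) and a is a nonnegative combination of simple roots, so it is
    positive at (a, b) for some simple b. *)
Lemma simple_descent a : a \in pos ->
  exists b, [/\ b \in F0, 0 < pr a b & (a == b) || (refl b a \in pos)].
Proof.
move=> aP; have aR := pos_root aP; have [_ [c cE]] := posP _ aP.
suff [b bF prb] : exists2 b, b \in F0 & 0 < pr a b.
  exists b; split => //; case: eqVneq => //= ab; exact: refl_simple_pos.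
have faa := rform_gt0 aR; rewrite {1}cE rform_suml in faa.
apply/not_exists2P => H; move: faa; apply/negP; rewrite -leNgt.
rewrite big_seq; apply: sumr_le0 => b bF; rewrite pmulrn rformZl.
have bR := simple_root bF.
have [//|] := H b; rewrite rformC => /negP; rewrite -leNgt.
have := rform_root a bR; have := rform_gt0 bR; nia.
Qed.

(** Induction on the height [coht]: by [simple_descent] a positive root that is not simple has a
    simple reflection that lowers it and keeps it positive. *)
Lemma pos_ind (P : 'cV[int]_r -> Prop) :
  {in F0, forall b, P b} ->
  (forall a b, a \in pos -> b \in F0 -> pr a b < 0 -> refl b a \in pos ->
     P a -> P (refl b a)) ->
  {in pos, forall a, P a}.
Proof.
move=> Pb Pr; suff H (a : 'cV[int]_r) : a \in pos -> P a by move=> a /H.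
move=> aP; have [n] := ubnP `|coht a|%N; elim: n => // n IH in a aP *.
move=> an; have [b [bF ab]] := simple_descent aP.
have bR := simple_root bF; have aR := pos_root aP.
case/orP => [/eqP -> | bap]; first exact: Pb.
rewrite -(reflK bR a); apply: Pr => //; rewrite ?reflK// ?pr_refl_self ?oppr_lt0//.
apply: IH => //.
have := coht_ge0 (posP _ bap).2; have := coht_ge0 (posP _ aP).2.
have -> : coht (refl b a) = coht a - 2 * pr a b.
  by rewrite /Defs.refl cohtB cohtZ (coht_simple bF).
move: (coht a) (pr a b) an ab => A B; lia.
Qed.

Lemma uniq_simple_coroots : uniq (simple_coroots D).
Proof.
rewrite map_inj_in_uniq ?fset_uniq// => a b /simple_root aR /simple_root bR.
exact: coroot_inj.
Qed.

Local Notation nnc := (nonneg_comb (simple_coroots D)).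

Lemma nnc_simple b : b \in F0 -> nnc (coroot D b).
Proof. by move=> bF; apply/nonneg_comb_mem/map_f/bF/uniq_simple_coroots. Qed.

(** Positivity is defined by roots alone. It passes to coroots because each step of [pos_ind] adds a
    nonnegative multiple of a simple coroot. *)
Lemma nnc_pos a : a \in pos -> nnc (coroot D a).
Proof.
move: a; apply: pos_ind => [b|a b aP bF ab baP nna]; first exact: nnc_simple.
have bR := simple_root bF; have aR := pos_root aP.
rewrite coroot_refl//; apply: nonneg_combD => //.
have ba : pr b a < 0.
  have := pr_gt0C aR bR; have := pr_eq0C aR bR; lia.
rewrite -mulrNz; case: (- pr b a) (oppr_gt0 (pr b a)); last by move=> n; rewrite ba.
by move=> n _; rewrite -pmulrn; apply/nonneg_combMn/nnc_simple.
Qed.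

Lemma nnc_ht y : nnc y -> 0 <= ht y /\ (ht y = 0 -> y = 0).
Proof.
move=> [c yE]; have hE : ht y = \sum_(b <- simple_coroots D) 2 * (c b)%:Z.
  rewrite yE /ht pairing_sumr; apply: eq_big_seq => _ /mapP[b bF ->].
  by rewrite pmulrn pairingZr -/(ht _) ht_simple.
rewrite hE; split=> [|/eqP]; first by apply: sumr_ge0 => b _; lia.
rewrite psumr_eq0 => [/allP H|b _]; last by lia.
rewrite yE big_seq big1// => b /H /=.
by rewrite mulf_eq0/= eqz_nat => /eqP ->.
Qed.

(** Positivity becomes the sign of one linear functional on coroots; this is what reduces
    [sep_closed] to integer arithmetic. *)
Lemma ht_pos a : a \in R0 -> (a \in pos) = (0 < ht (coroot D a)).
Proof.
have H b : b \in pos -> 0 < ht (coroot D b).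
  move=> bP; have [h0 h1] := nnc_ht (nnc_pos bP).
  rewrite lt_neqAle h0 andbT eq_sym; apply/eqP => /h1 /eqP.
  by rewrite (negbTE (coroot_neq0 (pos_root bP))).
move=> aR; apply/idP/idP => [/H//|]; apply: contraTT.
by rewrite -opp_posE// => /H; rewrite corootN// htN; lia.
Qed.

Lemma ht_neg a : a \in R0 -> (a \notin pos) = (ht (coroot D a) < 0).
Proof.
move=> aR; rewrite -opp_posE// ht_pos ?oppR// corootN// htN; lia.
Qed.

Lemma nnc_posP a : a \in R0 -> nnc (coroot D a) -> a \in pos.
Proof.
move=> aR /nnc_ht[h0 h1]; rewrite ht_pos// lt_neqAle h0 andbT eq_sym.
by apply: contra (coroot_neq0 aR) => /eqP /h1 ->.
Qed.

End Positivity.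

(** * Highest coroots *)

Section Highest.
Local Open Scope ring_scope.
Variables (r : nat) (D : based_root_datum r).
Implicit Types (a b c x y : 'cV[int]_r) (C : {fset 'cV[int]_r}).

Local Notation pr x a := (pairing D x (coroot D a)).
Local Notation R0 := (R0 D).
Local Notation F0 := (F0 D).
Local Notation refl := (refl D).
Local Notation pos := (pos_roots D).
Local Notation nnc := (nonneg_comb (simple_coroots D)).

Lemma seq_max (T : eqType) (s : seq T) (g : T -> int) (x0 : T) : x0 \in s ->
  exists2 x : T, x \in s & {in s, forall y : T, g y <= g x}.
Proof.
elim: s x0 => // z s IH x0 _; case: s IH => [_|u s IH].
  by exists z; rewrite ?mem_head// => y; rewrite inE => /eqP ->.
have [x xs xmax] := IH u (mem_head _ _); have [zx|xz] := leP (g z) (g x).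
  exists x; first by rewrite in_cons xs orbT.
  by move=> y; rewrite in_cons => /predU1P[->//|/xmax].
exists z; rewrite ?mem_head// => y; rewrite in_cons => /predU1P[->//|/xmax yx].
exact: le_trans yx (ltW xz).
Qed.

Lemma simple_obtuse a b : a \in F0 -> b \in F0 -> a != b -> pr a b <= 0.
Proof.
move=> aF bF ab; have := refl_simple_pos bF (simple_pos aF) ab.
case/posP => _ [d dE].
have /simple_free/(_ b bF) : \sum_(x <- F0)
    x *~ ((d x)%:Z - (x == a)%:R + (x == b)%:R * pr a b) = 0.
  under eq_bigr => x _ do rewrite mulrzDr mulrzBr -pmulrn.
  rewrite big_split sumrB/= -dE (bigD1_seq a)//= ?fset_uniq// eqxx.
  rewrite big1 => [|x /negbTE ->//]; rewrite addr0.
  rewrite (bigD1_seq b)//= ?fset_uniq// eqxx mul1r.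
  rewrite big1 => [|x /negbTE ->]; last by rewrite mul0r.
  by rewrite addr0 /Defs.refl mulr1z addrAC subrK subrr.
rewrite eqxx eq_sym (negbTE ab) mul1r subr0; lia.
Qed.

Lemma part_refl C a b : orthogonal_part D C -> a \in R0 -> b \in R0 ->
  coroot D b \in C -> coroot D (refl a b) \in C.
Proof.
move=> [_ Corth] aR bR bC; have [ab0|ab0] := eqVneq (pr a b) 0.
  by rewrite coroot_refl// ab0 mulr0z subr0.
apply/negPn/negP => cC; have [aC|aC] := boolP (coroot D a \in C).
  have := Corth _ _ aR (refl_root aR bR) aC cC.
  by rewrite pr_reflr// refl_self// pairingNl => /eqP; rewrite oppr_eq0 (negbTE ab0).
by have /eqP := Corth _ _ bR aR bC aC; rewrite pr_eq0C// (negbTE ab0).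
Qed.

Lemma part_mem C a b : orthogonal_part D C -> a \in R0 -> b \in R0 ->
  coroot D a \in C -> pr a b != 0 -> coroot D b \in C.
Proof.
move=> [_ Corth] aR bR aC; apply: contraR => bC; exact/eqP/Corth.
Qed.

Lemma nnc_scale b (m : int) : b \in F0 -> 0 <= m -> nnc (coroot D b *~ m).
Proof.
by case: m => // m bF _; rewrite -pmulrn; apply/nonneg_combMn/nnc_simple.
Qed.

Definition dominant a := {in F0, forall b, 0 <= pr b a}.

Lemma dominant_pr a b : dominant a -> b \in pos -> 0 <= pr b a.
Proof.
move=> da /posP[_ [c ->]]; rewrite pairing_suml big_seq.
by apply: sumr_ge0 => x xF; rewrite pmulrn pairingZl mulr_ge0// da.
Qed.

Lemma dominant_prC a b : a \in R0 -> dominant a -> b \in pos -> 0 <= pr a b.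
Proof.
move=> aR da bP; have bR := pos_root bP; have := dominant_pr da bP.
have := pr_gt0C aR bR; have := pr_eq0C aR bR; lia.
Qed.

Lemma dominant_pos a : a \in R0 -> dominant a -> a \in pos.
Proof.
move=> aR da; apply/negPn/negP; rewrite -opp_posE// => /(dominant_pr da).
by rewrite pairingNl pairing_coroot.
Qed.

Section Support.
Variables (C : {fset 'cV[int]_r}) (t a : 'cV[int]_r) (c : 'cV[int]_r -> nat).
Hypotheses (Cirr : irreducible_component D C) (tR : t \in R0) (aR : a \in R0).
Hypotheses (tC : coroot D t \in C) (aC : coroot D a \in C).
Hypotheses (tdom : dominant t) (adom : dominant a).
Hypothesis cE : coroot D a = \sum_(b <- F0) coroot D b *+ c b.

Let SI := [seq b <- F0 | (0 < c b)%N].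
Let SJ := [seq b <- F0 | (c b == 0)%N].

Let prI x : pr x a = \sum_(b <- F0) pr x b * (c b)%:Z.
Proof.
rewrite cE pairing_sumr; apply: eq_bigr => b _.
by rewrite pmulrn pairingZr.
Qed.

(** For j outside the support of the coroot of a, all terms of the pairing of j with it are
    nonpositive, while dominance makes the sum nonnegative. *)
Let IJ i j : i \in SI -> j \in SJ -> pr j i = 0.
Proof.
rewrite !mem_filter => /andP[ci iF] /andP[/eqP cj jF].
have := adom jF; rewrite prI => H.
have : \sum_(b <- F0) - (pr j b * (c b)%:Z) == 0.
  rewrite eq_le sumrN oppr_le0 H -sumrN big_seq; apply: sumr_ge0 => b bF.
  have [->|jb] := eqVneq b j; first by rewrite cj mulr0.
  by rewrite -mulNr mulr_ge0// oppr_ge0 simple_obtuse// eq_sym.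
rewrite big_seq psumr_eq0 => [/allP/(_ _ iF)|b bF].
  by rewrite iF/= oppr_eq0 mulf_eq0 eqz_nat -[c i == 0%N]negbK -lt0n ci orbF => /eqP.
have [->|jb] := eqVneq b j; first by rewrite cj mulr0.
by rewrite -mulNr mulr_ge0// oppr_ge0 simple_obtuse// eq_sym.
Qed.

Let orth_comb (S1 S2 : seq 'cV[int]_r) x y :
  {subset S2 <= R0} ->
  {in S1 & S2, forall i j, pr i j = 0} ->
  nonneg_comb S1 x -> nonneg_comb S2 y -> rform D x y = 0.
Proof.
move=> S2R H [d ->] [e ->]; rewrite rform_suml big_seq big1// => i iS.
rewrite pmulrn rformZl rformC rform_suml big_seq big1 ?mul0r// => j jS.
have jR := S2R j jS.
rewrite pmulrn rformZl rformC; have := rform_root i jR; rewrite H// mulr0.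
by move=> /eqP; rewrite mulf_eq0/= => /eqP ->; rewrite mul0r.
Qed.

Let SIR : {subset SI <= R0}.
Proof. by move=> x; rewrite mem_filter => /andP[_ /simple_root]. Qed.
Let SJR : {subset SJ <= R0}.
Proof. by move=> x; rewrite mem_filter => /andP[_ /simple_root]. Qed.

Let JI i j : i \in SI -> j \in SJ -> pr i j = 0.
Proof.
by move=> iI jJ; apply/eqP; rewrite (pr_eq0C (SIR iI) (SJR jJ)) (IJ iI jJ).
Qed.

(** In [pos_ind] the simple root b is never orthogonal to x, whereas SI and SJ are mutually
    orthogonal; so b lies in the same block as x. *)
Let split x : x \in pos -> nonneg_comb SI x \/ nonneg_comb SJ x.
Proof.
move: x; apply: pos_ind => [b bF|x b xP bF xb _ H].
  have [b0|b0] := posnP (c b).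
    by right; apply: nonneg_comb_mem; rewrite ?filter_uniq ?fset_uniq// mem_filter b0 eqxx.
  by left; apply: nonneg_comb_mem; rewrite ?filter_uniq ?fset_uniq// mem_filter b0.
have bR := simple_root bF.
have xb0 : rform D x b != 0.
  by rewrite rform_pr_eq0// lt_eqF.
have xbE S : b \in S -> uniq S -> nonneg_comb S x -> nonneg_comb S (refl b x).
  move=> bS uS Sx; rewrite /Defs.refl -mulrNz.
  case: (- pr x b) (oppr_gt0 (pr x b)) => [n _|n]; last by rewrite xb.
  by rewrite -pmulrn; apply/nonneg_combD/nonneg_combMn/nonneg_comb_mem.
have [bI|bI] := boolP (b \in SI).
  case: H => H; [left|exfalso; move/eqP: xb0; apply].
    by apply: xbE; rewrite ?filter_uniq ?fset_uniq.
  apply: orth_comb SIR _ H (nonneg_comb_mem _ bI) => [j i jJ iI|]; first exact: IJ.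
  by rewrite filter_uniq ?fset_uniq.
have bJ : b \in SJ.
  by move: bI; rewrite !mem_filter bF !andbT lt0n negbK.
case: H => H; [exfalso; move/eqP: xb0; apply|right].
  apply: orth_comb SJR _ H (nonneg_comb_mem _ bJ) => [i j iI jJ|]; first exact: JI.
  by rewrite filter_uniq ?fset_uniq.
by apply: xbE; rewrite ?filter_uniq ?fset_uniq.
Qed.

Let tyI x := nonneg_comb SI x \/ nonneg_comb SI (- x).
Let tyJ x := nonneg_comb SJ x \/ nonneg_comb SJ (- x).

Let splitR x : x \in R0 -> tyI x \/ tyJ x.
Proof.
move=> xR; have [/split[]|] := boolP (x \in pos); [by left; left|by right; left|].
by rewrite -opp_posE// => /split[]; [left; right|right; right].
Qed.

Let rformNr x y : rform D x (- y) = - rform D x y.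
Proof. by rewrite rformC rformNl rformC. Qed.

Let tyIJ x y : tyI x -> tyJ y -> rform D x y = 0.
Proof.
by move=> [h|h] [k|k]; have := orth_comb SJR JI h k;
  rewrite ?rformNl ?rformNr => /eqP; rewrite ?oppr_eq0 => /eqP.
Qed.

(* The simple roots occurring in the coroot of a are orthogonal to all other *)
(* simple roots (a is dominant), so they cut out an orthogonal part of C.    *)
(* This part is C itself; if t were orthogonal to a, the dominant root t     *)
(* would be orthogonal to every simple root occurring in it.                 *)
Lemma dominant_not_orth : pr t a != 0.
Proof.
apply/eqP => ta; have [C0 [CR Corth] Cmin] := Cirr.
pose C' := [fset x in C | `[< exists y, [/\ y \in R0, x = coroot D y & tyI y] >]]%fset.
have inC' x : x \in R0 -> (coroot D x \in C') -> tyI x.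
  move=> xR; rewrite !inE => /andP[_ /asboolP[y [yR e ty]]].
  by rewrite (coroot_inj xR yR e).
have C'in x : x \in R0 -> coroot D x \in C -> tyI x -> coroot D x \in C'.
  by move=> xR xC tx; rewrite !inE xC/=; apply/asboolP; exists x.
have aI : tyI a.
  have [//|aJ] := splitR aR; have := pairing_coroot aR; rewrite prI big_seq big1// => b bF.
  have [->|b0] := posnP (c b); first by rewrite mulr0.
  have bI : b \in SI by rewrite mem_filter b0.
  have tyb : tyI b.
    by left; apply: nonneg_comb_mem; rewrite ?filter_uniq ?fset_uniq.
  suff -> : pr a b = 0 by rewrite mul0r.
  by apply/eqP; rewrite -(rform_pr_eq0 _ (SIR bI)) rformC (tyIJ tyb aJ).
have tI : tyI t.
  apply: (inC') => //; rewrite (Cmin C')//.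
  - by apply/fset0Pn; exists (coroot D a); apply: C'in.
  - by move=> x; rewrite !inE => /andP[].
  split=> [x|x y xR yR xC' yC']; first by rewrite !inE => /andP[/CR].
  have [yC|yC] := boolP (coroot D y \in C); last first.
    by apply: Corth => //; move: xC'; rewrite !inE => /andP[].
  have [yI|yJ] := splitR yR; first by move: yC'; rewrite C'in.
  by apply/eqP; rewrite -(rform_pr_eq0 _ yR) (tyIJ (inC' _ xR xC') yJ).
have tb0 b : b \in SI -> pr t b = 0.
  move=> bI; have : \sum_(b <- F0) pr t b * (c b)%:Z == 0 by rewrite -prI ta.
  have bF : b \in F0 by move: bI; rewrite mem_filter => /andP[].
  rewrite big_seq psumr_eq0 => [/allP/(_ _ bF)|x xF].
    rewrite bF/= mulf_eq0 eqz_nat; move: bI; rewrite mem_filter => /andP[cb _].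
    by rewrite -[c b == 0%N]negbK -lt0n cb orbF => /eqP.
  by rewrite mulr_ge0// dominant_prC// simple_pos.
have : rform D t t = 0.
  have H y : nonneg_comb SI y -> rform D t y = 0.
    move=> [d ->]; rewrite rformC rform_suml big_seq big1// => b bI.
    rewrite pmulrn rformZl rformC; have := rform_root t (SIR bI).
    by rewrite tb0// mulr0 => /eqP; rewrite mulf_eq0/= => /eqP ->; rewrite mul0r.
  by case: tI => /H// /eqP; rewrite rformNr oppr_eq0 => /eqP.
by move=> tt; have := rform_gt0 tR; rewrite tt ltxx.
Qed.

End Support.

Lemma nnc_coefs y : nnc y ->
  exists c : 'cV[int]_r -> nat, y = \sum_(b <- F0) coroot D b *+ c b.
Proof. by move=> [d ->]; exists (d \o coroot D); rewrite big_map. Qed.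

Lemma dominant_step C a b : orthogonal_part D C -> a \in R0 -> b \in F0 ->
  coroot D a \in C -> pr b a < 0 ->
  [/\ coroot D (refl b a) \in C,
      nnc (coroot D (refl b a) - coroot D a) &
      ht D (coroot D a) < ht D (coroot D (refl b a))].
Proof.
move=> Co aR bF aC ba; have bR := simple_root bF; split; first exact: part_refl.
  rewrite coroot_refl// addrAC subrr add0r -mulrNz.
  by apply: nnc_scale => //; rewrite oppr_ge0 ltW.
by rewrite coroot_refl// htB htZ (ht_simple bF); move: (ht D _) (pr b a) ba => A B; lia.
Qed.

(* If t has maximal height in C and a has maximal height among the roots of  *)
(* C whose coroot is not below that of t, then both are dominant, hence not  *)
(* orthogonal, and the difference of their coroots is 0 or a coroot.         *)
Lemma irreducible_highest C : irreducible_component D C ->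
  exists t, [/\ t \in R0, coroot D t \in C &
    {in C, forall c, nnc (coroot D t - c)}].
Proof.
move=> Cirr; have [/fset0Pn[c0 c0C] Co _] := Cirr; have [CR _] := Co.
have [ct tC tmax] := seq_max (ht D) c0C.
have /mapP[t tR tE] := CR _ tC; subst ct.
exists t; split => //.
have tdom : dominant t.
  move=> b bF; rewrite leNgt; apply/negP => tb.
  have [bC _] := dominant_step Co tR bF tC tb.
  by rewrite ltNge tmax.
pose bad := [seq c <- C | ~~ `[< nnc (coroot D t - c) >]].
suff /eqP bad0 : bad == [::].
  move=> c cC; apply: contrapT => tc.
  have : c \in bad by rewrite mem_filter cC andbT; apply/negP => /asboolP.
  by rewrite bad0.
apply/negPn/negP; case E : bad => [//|c1 s] _.
have c1b : c1 \in bad by rewrite E mem_head.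
have {s E c1 c1b} [ca] := seq_max (ht D) c1b.
rewrite mem_filter => /andP[/asboolP ta caC] amax.
have /mapP[a aR aE] := CR _ caC; subst ca.
have adom : dominant a.
  move=> b bF; rewrite leNgt; apply/negP => ab.
  have [bC ba] := dominant_step Co aR bF caC ab.
  rewrite ltNge amax//.
  rewrite mem_filter bC andbT; apply/asboolP => tb; apply: ta.
  by rewrite -(subrK (coroot D (refl b a)) (coroot D t)) -addrA; apply: nonneg_combD.
have aP := dominant_pos aR adom.
have hat : ht D (coroot D a) <= ht D (coroot D t) by apply: tmax.
have [c cE] := nnc_coefs (nnc_pos aP).
have ta0 := dominant_not_orth Cirr tR aR tC caC tdom adom cE.
have tap : 0 < pr t a by rewrite lt_neqAle eq_sym ta0 dominant_prC.
have atp : 0 < pr a t by rewrite pr_gt0C.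
have [nta|nta] := leP 2 (pr t a); last first.
  have ta1 : pr t a = 1 by lia.
  have eta := coroot_refl tR aR; rewrite ta1 mulr1z in eta.
  have rR := refl_root tR aR.
  have := ht_pos rR; have := nnc_pos (D := D) (a := refl t a).
  rewrite eta htB; case: (refl t a \in pos) (opp_posE rR) => [_ _|/= rP _ _].
    by rewrite subr_gt0 ltNge hat.
  by apply: ta; rewrite -opprB -eta -corootN//; apply: nnc_pos.
have [nat|nat] := leP 2 (pr a t); last first.
  have at1 : pr a t = 1 by lia.
  have eta := coroot_refl aR tR; rewrite at1 mulr1z in eta.
  have rR := refl_root aR tR.
  have := ht_neg rR; have := nnc_pos (D := D) (a := refl a t).
  rewrite eta htB; case: (refl a t \in pos) => [/(_ isT)//|_ /=].
  by rewrite subr_lt0 ltNge hat.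
by apply: ta; rewrite (pr_ge2_eq tR aR nta nat) subrr; apply: nonneg_comb0.
Qed.

(** Induction on the size of C: if C' is a proper part of C, then C' and its complement in C are
    both orthogonal parts, and c lies in one of them. *)
Lemma irreducible_component_mem C c : orthogonal_part D C -> c \in C ->
  exists2 C0, irreducible_component D C0 & c \in C0.
Proof.
have [n] := ubnP #|` C|; elim: n => // n IH in C *; rewrite ltnS => Cn Co cC.
have [Cirr|/existsNP[C' H]] := pselect (forall C' : {fset 'cV[int]_r},
    C' != fset0 -> {subset C' <= C} -> orthogonal_part D C' -> C' = C).
  by exists C => //; split => //; apply/fset0Pn; exists c.
move: H => /not_implyP[C'0] /not_implyP[C'C] /not_implyP[C'o] CC'.
have C'C0 : (C' `<=` C)%fset by apply/fsubsetP.
have ltC' : (#|` C'| < #|` C|)%N.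
  by apply: fproper_ltn_card; rewrite fproperEneq C'C0 andbT; apply/eqP.
have [cC'|cC'] := boolP (c \in C').
  by apply: (IH C') => //; apply: leq_trans Cn.
apply: (IH (C `\` C')%fset) => //; last by rewrite !inE cC cC'.
  have /fset0Pn[d dC'] := C'0.
  apply: leq_trans Cn; apply: fproper_ltn_card; rewrite fproperEneq fsubsetDl andbT.
  apply/eqP => /fsetP/(_ d); by rewrite !inE dC' (C'C _ dC').
have [CR Corth] := Co; have [_ C'orth] := C'o.
split=> [x|x y xR yR]; first by rewrite !inE => /andP[_ /CR].
rewrite !inE => /andP[xC' xC]; rewrite negb_and negbK => /orP[yC'|yC]; last exact: Corth.
by apply/eqP; rewrite pr_eq0C// C'orth.
Qed.

Lemma highest_above a : a \in R0 -> exists t,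
  [/\ t \in R0, highest_coroot D (coroot D t) & nnc (coroot D t - coroot D a)].
Proof.
move=> aR; pose C := seq_fset tt (coroots D).
have Co : orthogonal_part D C.
  split=> [x|x y xR yR _]; first by rewrite seq_fsetE.
  by rewrite seq_fsetE map_f.
have aC : coroot D a \in C by rewrite seq_fsetE map_f.
have [C0 C0irr aC0] := irreducible_component_mem Co aC.
have [t [tR tC tmax]] := irreducible_highest C0irr.
by exists t; split; [|exists C0|exact: tmax].
Qed.

Section HighestPairing.
Variable t : 'cV[int]_r.
Hypotheses (tR : t \in R0) (thigh : highest_coroot D (coroot D t)).

Lemma highest_dominant : dominant t.
Proof.
have [C [[_ Co _] tC tmax]] := thigh.
move=> b bF; rewrite leNgt; apply/negP => tb.
have [bC _ bt] := dominant_step Co tR bF tC tb.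
by have [] := nnc_ht (tmax _ bC); rewrite htB; lia.
Qed.

Lemma highest_pos : t \in pos.
Proof. exact/dominant_pos/highest_dominant. Qed.

Lemma highest_pr_ge0 a : a \in pos -> 0 <= pr t a.
Proof. exact/dominant_prC/highest_dominant. Qed.

Lemma highest_nnc a : a \in R0 -> pr t a != 0 -> nnc (coroot D t - coroot D a).
Proof.
move=> aR ta; have [C [[_ Co _] tC tmax]] := thigh.
exact/tmax/(part_mem Co tR aR tC).
Qed.

(** If the pairing n of t with a were at least 2, the coroot of - s_t a, which is n times that of t
    minus that of a, would lie below the highest coroot. Then a has at least the height of t, and
    [highest_nnc] makes the coroots equal. *)
Lemma highest_pr_le1 a : a \in R0 -> a != t -> pr t a <= 1.
Proof.
move=> aR; apply: contraNT; rewrite -ltNge => ta.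
have ta0 : pr t a != 0 by lia.
have n1 := highest_nnc aR ta0.
have rR := refl_root tR aR.
have n2 : nnc (coroot D t - coroot D (- refl t a)).
  apply: highest_nnc; rewrite ?oppR// prN// pr_reflr// refl_self// pairingNl opprK//.
have [h0 h1] := nnc_ht n1; have [h2 _] := nnc_ht n2.
have := highest_pos; rewrite ht_pos// => tP.
rewrite corootN// coroot_refl// htB htN htB htZ in h2.
rewrite htB in h0 h1.
suff /h1/eqP : ht D (coroot D t) - ht D (coroot D a) = 0.
  by rewrite subr_eq0 => /eqP/(coroot_inj tR aR)/esym/eqP.
move: (ht D _) (ht D _) (pr t a) ta h0 h2 tP => A B n {h1}; nia.
Qed.

Lemma highest_refl_neg a : a \in R0 -> pr t a = 1 -> refl t a \notin pos.
Proof.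
move=> aR ta; have rR := refl_root tR aR.
have ta0 : pr t a != 0 by rewrite ta.
rewrite -opp_posE//; apply: nnc_posP; rewrite ?oppR//.
by rewrite corootN// coroot_refl// ta mulr1z opprB; apply: highest_nnc.
Qed.

End HighestPairing.

End Highest.

(** * The length function *)

Section Weyl.
Local Open Scope ring_scope.
Variables (r : nat) (D : based_root_datum r).
Implicit Types (a b c x y : 'cV[int]_r) (A B : 'M[int]_r) (g u v s : affweyl D).

Local Notation pr x a := (pairing D x (coroot D a)).
Local Notation R0 := (R0 D).
Local Notation F0 := (F0 D).
Local Notation refl := (refl D).
Local Notation pos := (pos_roots D).
Local Notation nnc := (nonneg_comb (simple_coroots D)).
Local Notation lin g := (val (snd g)).

Lemma lin_weyl g : in_weyl D (lin g).
Proof. exact: asboolW (valP g.2). Qed.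

Lemma mulmxMz A x k : A *m (x *~ k) = (A *m x) *~ k.
Proof. by rewrite -!scaler_int -scalemxAr. Qed.

Lemma weyl_root A a : in_weyl D A -> a \in R0 -> A *m a \in R0.
Proof.
move=> wA aR; elim: wA => [|b B bR _ IH]; first by rewrite mul1mx.
by rewrite -mulmxA refl_mxE refl_root.
Qed.

Lemma weyl_pr A x a : in_weyl D A -> a \in R0 -> pr (A *m x) (A *m a) = pr x a.
Proof.
move=> wA aR; elim: wA => [|b B bR wB IH]; first by rewrite !mul1mx.
by rewrite -!mulmxA !refl_mxE pr_refl// weyl_root.
Qed.

Lemma mulmx_inj A B : (forall x, A *m x = B *m x) -> A = B.
Proof.
move=> H; apply/matrixP => i j; have /colP/(_ i) := H (delta_mx j 0).
by rewrite -!colE !mxE.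
Qed.

Lemma refl_mxK a : a \in R0 -> refl_mx D a *m refl_mx D a = 1%:M.
Proof.
by move=> aR; apply: mulmx_inj => x; rewrite -mulmxA !refl_mxE reflK// mul1mx.
Qed.

Lemma weyl_inv_ex A : in_weyl D A -> exists2 B, in_weyl D B & B *m A = 1%:M.
Proof.
elim=> [|a A' aR _ [B wB BA]]; first by exists 1%:M; [exact: in_weyl1|rewrite mul1mx].
exists (B *m refl_mx D a); first exact/in_weyl_mul/in_weyl_refl.
by rewrite -mulmxA [refl_mx D a *m _]mulmxA refl_mxK// mul1mx.
Qed.

Lemma weyl_unit A : in_weyl D A -> A \in unitmx.
Proof. by move=> /weyl_inv_ex[B _ /mulmx1_unit[]]. Qed.

Lemma weyl_invmx A : in_weyl D A -> in_weyl D (invmx A).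
Proof.
move=> wA; have [B wB BA] := weyl_inv_ex wA.
by rewrite -[invmx A]mul1mx -BA -mulmxA mulmxV ?weyl_unit// mulmx1.
Qed.

Definition weyl_inv (w : weyl D) : weyl D :=
  exist _ (invmx (val w)) (asboolT (weyl_invmx (asboolW (valP w)))).

Definition aff_inv g : affweyl D := (- (invmx (lin g) *m g.1), weyl_inv g.2).

Lemma aff_eq g g' : g.1 = g'.1 -> lin g = lin g' -> g = g'.
Proof. by case: g g' => [x w] [x' w'] /= -> /val_inj ->. Qed.

Lemma aff_mulA u v g : aff_mul u (aff_mul v g) = aff_mul (aff_mul u v) g.
Proof. by apply: aff_eq; rewrite /= ?mulmxDr ?mulmxA ?addrA. Qed.

Lemma aff_mul1 g : aff_mul g (aff_one D) = g.
Proof. by apply: aff_eq; rewrite /= ?mulmx0 ?addr0 ?mulmx1. Qed.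

Lemma aff_1mul g : aff_mul (aff_one D) g = g.
Proof. by apply: aff_eq; rewrite /= ?add0r mul1mx. Qed.

Lemma aff_invr g : aff_mul g (aff_inv g) = aff_one D.
Proof.
by apply: aff_eq; rewrite /= ?mulmxN ?mulKVmx ?subrr ?mulmxV ?weyl_unit//; apply: lin_weyl.
Qed.

Lemma aff_invl g : aff_mul (aff_inv g) g = aff_one D.
Proof.
by apply: aff_eq; rewrite /= ?addNr ?mulVmx ?weyl_unit//; apply: lin_weyl.
Qed.

Lemma aff_inv_uniq g g' : aff_mul g g' = aff_one D -> aff_inv g = g'.
Proof.
by move=> e; rewrite -[aff_inv g]aff_mul1 -e aff_mulA aff_invl aff_1mul.
Qed.

Lemma aff_invM u v : aff_inv (aff_mul u v) = aff_mul (aff_inv v) (aff_inv u).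
Proof.
by apply: aff_inv_uniq; rewrite aff_mulA -(aff_mulA u) aff_invr aff_mul1 aff_invr.
Qed.

Lemma lin_root g a : a \in R0 -> lin g *m a \in R0.
Proof. exact/weyl_root/lin_weyl. Qed.

Lemma lin_inj g : injective (mulmx (lin g) : 'cV_r -> 'cV_r).
Proof. by apply: can_inj (mulKmx (weyl_unit (lin_weyl g))). Qed.

Lemma perm_lin g : perm_eq [seq lin g *m a | a <- R0] R0.
Proof.
have us : uniq [seq lin g *m a | a <- R0].
  by rewrite map_inj_uniq ?fset_uniq//; apply: lin_inj.
have sub : {subset [seq lin g *m a | a <- R0] <= R0}.
  by move=> _ /mapP[a aR ->]; apply: lin_root.
apply: uniq_perm => //; first exact: fset_uniq.
by have [] := uniq_min_size us sub; rewrite ?size_map.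
Qed.

(* The number of hyperplanes of direction a that separate the fundamental  *)
(* alcove from its image under g^-1, counted with sign.                    *)
Definition sep g a : int :=
  pr g.1 (lin g *m a) + (lin g *m a \notin pos)%:R - (a \notin pos)%:R.

Lemma sepN g a : a \in R0 -> sep g (- a) = - sep g a.
Proof.
move=> aR; have gaR := lin_root g aR.
rewrite /sep mulmxN prN// !opp_posE// !negbK; move: (pairing D _ _) => N.
by case: (lin g *m a \in pos); case: (a \in pos); rewrite /= ?mulr1n ?mulr0n; lia.
Qed.

Lemma sepM g g' a : a \in R0 ->
  sep (aff_mul g g') a = sep g' a + sep g (lin g' *m a).
Proof.
move=> aR; rewrite /sep /= pairingDl -!mulmxA.
rewrite (weyl_pr g'.1 (lin_weyl g) (lin_root g' aR)).
ring.
Qed.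

Lemma sep1 a : sep (aff_one D) a = 0.
Proof. by rewrite /sep /= mul1mx pairing0l add0r subrr. Qed.

Lemma sepV g a : a \in R0 -> sep (aff_inv g) (lin g *m a) = - sep g a.
Proof.
by move=> aR; apply/eqP; rewrite -addr_eq0 addrC -sepM// aff_invl sep1.
Qed.

Lemma perm_pos : perm_eq R0 (pos ++ [seq - a | a <- pos]).
Proof.
apply: uniq_perm; rewrite ?fset_uniq//.
  rewrite cat_uniq pos_uniq (map_inj_uniq oppr_inj) pos_uniq.
  by rewrite andbT; apply/hasPn => _ /mapP[a aP ->]; apply: pos_oppN.
move=> a; rewrite mem_cat; apply/idP/orP => [aR|[/pos_root//|/mapP[b /pos_root bR ->]]].
  have [|] := boolP (a \in pos); first by left.
  by rewrite -opp_posE// => aP; right; apply/mapP; exists (- a); rewrite ?opprK.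
by rewrite oppR.
Qed.

(** The two sums in [len] run over the positive roots made negative, where [sep] has the extra 1,
    and those kept positive. The pairing with x = w^-1 y is carried to y by W_0-invariance. *)
Lemma len_sep g : len g = (\sum_(a <- pos) `|sep g a|)%N.
Proof.
have wg := lin_weyl g.
rewrite /len [RHS](bigID (fun a => lin g *m a \in neg_roots D))/=.
have H a : a \in pos -> (lin g *m a \in neg_roots D) = (lin g *m a \notin pos).
  move=> /pos_root aR; rewrite -opp_posE ?lin_root//.
  apply/mapP/idP => [[b bP ->]|gP]; first by rewrite opprK.
  by exists (- (lin g *m a)); rewrite ?opprK.
have prE a : a \in pos -> pr (invmx (lin g) *m g.1) a = pr g.1 (lin g *m a).
  by move=> /pos_root aR; rewrite -(weyl_pr _ wg aR) mulKVmx ?weyl_unit.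
congr (_ + _)%N; first rewrite [LHS]big_seq_cond [RHS]big_seq_cond.
  apply: eq_bigr => a /andP[aP]; rewrite H// prE// /sep aP => ->.
  by rewrite subr0.
rewrite [LHS]big_seq_cond [RHS]big_seq_cond.
apply: eq_big => [a|a /andP[aP]].
  by have [aP|//] := boolP (a \in pos); rewrite /= H// negbK.
by rewrite prE// /sep aP => ->; rewrite addr0 subr0.
Qed.

(** Summed over all of R_0, a set that linear parts permute, the length can be reindexed without
    tracking signs. *)
Lemma len_sep2 g : (len g).*2 = (\sum_(a <- R0) `|sep g a|)%N.
Proof.
rewrite (perm_big _ perm_pos)/= big_cat big_map/= -addnn len_sep; congr (_ + _)%N.
by rewrite big_seq [RHS]big_seq; apply: eq_bigr => a /pos_root aR; rewrite sepN// abszN.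
Qed.

Lemma len_inv g : len (aff_inv g) = len g.
Proof.
apply: double_inj; rewrite !len_sep2 -(perm_big _ (perm_lin g))/= big_map.
by rewrite big_seq [RHS]big_seq; apply: eq_bigr => a aR; rewrite sepV// abszN.
Qed.

Lemma len0_sep g : len g = 0%N -> {in R0, forall a, sep g a = 0}.
Proof.
move=> g0 a aR; apply/eqP; rewrite -absz_eq0.
have /eqP : (\sum_(a <- R0) `|sep g a|)%N = 0%N by rewrite -len_sep2 g0.
by rewrite sum_nat_seq_eq0 => /allP/(_ a aR).
Qed.

Lemma len_mul0 u v : len v = 0%N -> len (aff_mul u v) = len u.
Proof.
move=> v0; apply: double_inj; rewrite !len_sep2 -[RHS](perm_big _ (perm_lin v))/= big_map.
rewrite big_seq [RHS]big_seq; apply: eq_bigr => a aR.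
by rewrite sepM// (len0_sep v0)// add0r.
Qed.

Lemma len1 : len (aff_one D) = 0%N.
Proof. by rewrite len_sep big1// => a _; rewrite sep1. Qed.

(** N and M are pairings with the translation part of g, H and K heights of the images of the two
    coroots, h and k heights of the coroots themselves. *)
Lemma sep_closed_arith (N M H K h k : int) (n : nat) :
  0 < N + (H < 0)%R%:R - (h < 0)%R%:R -> 0 < M + (K < 0)%R%:R - (k < 0)%R%:R ->
  0 < N + M * n%:Z + (H + K * n%:Z < 0)%R%:R - (h + k * n%:Z < 0)%R%:R.
Proof.
move=> NP MP; have [->|n0] := posnP n; first by rewrite !mulr0 !addr0.
have MnP : n%:Z <= (M + (K < 0)%R%:R - (k < 0)%R%:R) * n%:Z.
  by rewrite -{1}[n%:Z]mul1r ler_pM2r//; lia.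
move: MnP NP; rewrite mulrBl mulrDl {MP}.
have := @ler_wpM2r _ n%:Z; move: (M * n%:Z) => Mn mon.
have Kn : (K < 0) = (K * n%:Z < 0) by rewrite pmulr_llt0.
have kn : (k < 0) = (k * n%:Z < 0) by rewrite pmulr_llt0.
rewrite {}Kn {}kn {mon}; move: (K * _) (k * _) => Kn kn.
case: (ltP H 0); case: (ltP h 0); case: (ltP Kn 0); case: (ltP kn 0);
case: (ltP (H + Kn) 0); case: (ltP (h + kn) 0); rewrite /= ?mulr1n ?mulr0n; lia.
Qed.

(** With n = - [pr c a], a nonnegative integer, the coroot of s_c a is that of a plus n times that
    of c. Pairings and heights are additive, so only the sign corrections in [sep] need care. *)
Lemma sep_closed g a c : a \in R0 -> c \in R0 -> pr c a <= 0 ->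
  0 < sep g a -> 0 < sep g c -> 0 < sep g (refl c a).
Proof.
move=> aR cR ca0; have gaR := lin_root g aR; have gcR := lin_root g cR.
have E : lin g *m refl c a = refl (lin g *m c) (lin g *m a).
  by rewrite /Defs.refl mulmxBr mulmxMz weyl_pr//; apply: lin_weyl.
have wE : pr (lin g *m c) (lin g *m a) = pr c a by rewrite weyl_pr//; exact: lin_weyl.
have rR : refl c a \in R0 by rewrite refl_root.
rewrite /sep E !ht_neg ?refl_root// !coroot_refl// wE !htB !htZ pairingBr pairingZr.
have [n nE] : exists n : nat, pr c a = - n%:Z by exists `|pr c a|%N; lia.
rewrite nE !mulrN !opprK; exact: sep_closed_arith.
Qed.

End Weyl.

(** * Simple affine reflections and the exchange property *)

Section AffineReflections.
Local Open Scope ring_scope.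
Variables (r : nat) (D : based_root_datum r).
Implicit Types (a b c x y : 'cV[int]_r) (g u v s : affweyl D).

Local Notation pr x a := (pairing D x (coroot D a)).
Local Notation R0 := (R0 D).
Local Notation F0 := (F0 D).
Local Notation refl := (refl D).
Local Notation pos := (pos_roots D).
Local Notation nnc := (nonneg_comb (simple_coroots D)).
Local Notation lin g := (val (snd g)).

(* The linear part alone does not determine the sign of a: [sep s a = 1]   *)
(* makes a positive for a finite reflection, and a = - t for t_t s_t.      *)
Definition wall_refl s a := [/\ a \in R0, lin s = refl_mx D a,
  exists k : int, s.1 = a *~ k, sep s a = 1 &
  {in R0, forall c, c != a -> c != - a -> sep s c = 0}].

Lemma refl_mxN a : a \in R0 -> refl_mx D (- a) = refl_mx D a.
Proof.
move=> aR; apply: mulmx_inj => x; rewrite !refl_mxE /Defs.refl prN//.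
by rewrite mulrNz mulNrz opprK.
Qed.

Lemma wall_refl_finite (a : R0) : val a \in F0 -> wall_refl (0, weyl_refl a) (val a).
Proof.
move=> aF; have aR := valP a; split => //=; first by exists 0; rewrite mulr0z.
  rewrite /sep /= refl_mxE refl_self// pairing0l (pos_oppN (simple_pos aF)).
  by rewrite (simple_pos aF) /= add0r subr0.
move=> c cR ca cNa; rewrite /sep /= refl_mxE pairing0l add0r.
suff -> : (refl (val a) c \in pos) = (c \in pos) by rewrite subrr.
have H b : b \in pos -> b != val a -> refl (val a) b \in pos by exact: refl_simple_pos.
have [cP|cN] := boolP (c \in pos); first exact: H.
apply/negbTE; rewrite -opp_posE ?refl_root//.
have -> : - refl (val a) c = refl (val a) (- c).
  by rewrite -[- c]sub0r reflB /Defs.refl pairing0l mulr0z subr0 sub0r.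
by apply: H; rewrite ?opp_posE// eqr_oppLR.
Qed.

(** A positive root c other than t pairs with t to 0 or 1. In the first case s_t fixes c; in the
    second s_t c is negative, and this jump cancels the translation by t. *)
Lemma wall_refl_affine (t : R0) : highest_coroot D (coroot D (val t)) ->
  wall_refl (val t, weyl_refl t) (- val t).
Proof.
move=> tH; have tR := valP t; have tP := highest_pos tR tH.
split; rewrite ?oppR//=; first by rewrite refl_mxN.
- by exists (-1); rewrite mulrNz mulr1z opprK.
- have e : refl (val t) (- val t) = val t by rewrite -(refl_self tR) reflK.
  by rewrite /sep /= refl_mxE e pairing_coroot// tP pos_oppN.
have H c : c \in pos -> c != val t -> sep (val t, weyl_refl t) c = 0.
  move=> cP ct; have cR := pos_root cP.
  rewrite /sep /= refl_mxE cP /= pr_reflr// refl_self// pairingNl.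
  have := highest_pr_ge0 tR tH cP; have := highest_pr_le1 tR tH cR ct => le1 ge0.
  have [t0|t0] := eqVneq (pr (val t) c) 0.
    have ct0 : pr c (val t) = 0 by apply/eqP; rewrite pr_eq0C// t0.
    by rewrite t0 /Defs.refl ct0 mulr0z !subr0 cP.
  have t1 : pr (val t) c = 1 by move: (pr _ c) le1 ge0 t0 => n; lia.
  by rewrite t1 (highest_refl_neg tR tH cR t1).
move=> c cR cNt ct; rewrite opprK in ct.
have [cP|cN] := boolP (c \in pos); first exact: H.
by rewrite -[c]opprK sepN ?oppR// H ?oppr0// ?opp_posE// eqr_oppLR.
Qed.

Lemma Saff_simple b (bR : b \in R0) : b \in F0 ->
  ((0, weyl_refl [` bR]%fset) : affweyl D) \in Saff D.
Proof.
move=> bF; rewrite mem_cat; apply/orP; left; apply/mapP; exists [` bR]%fset => //.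
by rewrite mem_filter bF mem_enum.
Qed.

Lemma Saff_highest b (bR : b \in R0) : highest_coroot D (coroot D b) ->
  ((b, weyl_refl [` bR]%fset) : affweyl D) \in Saff D.
Proof.
move=> bH; rewrite mem_cat; apply/orP; right.
apply/mapP; exists [` bR]%fset => //.
by rewrite mem_filter mem_enum andbT; apply/asboolP.
Qed.

Section Wall.
Variables (s : affweyl D) (a : 'cV[int]_r).
Hypothesis sa : wall_refl s a.

Let aR : a \in R0. Proof. by case: sa. Qed.
Let linE x : lin s *m x = refl a x.
Proof. by have [_ -> _ _ _] := sa; rewrite refl_mxE. Qed.
Let aNa : a != - a.
Proof.
apply/eqP => e; have := pairing_coroot aR.
by rewrite {1}e pairingNl pairing_coroot.
Qed.

Lemma wall_invol : aff_mul s s = aff_one D.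
Proof.
have [_ lE [k kE] _ _] := sa; apply: aff_eq => /=; last by rewrite lE refl_mxK.
rewrite linE kE reflMz refl_self// mulNrz subrr//.
Qed.

Lemma wall_inv : aff_inv s = s.
Proof. exact/aff_inv_uniq/wall_invol. Qed.

Lemma wall_mulK g : aff_mul (aff_mul g s) s = g.
Proof. by rewrite -aff_mulA wall_invol aff_mul1. Qed.

Lemma sep_wall g c : c \in R0 -> c != a -> c != - a ->
  sep (aff_mul g s) c = sep g (refl a c).
Proof.
by move=> cR ca cNa; have [_ _ _ _ s0] := sa; rewrite sepM// s0// add0r linE.
Qed.

Lemma sep_wall_self g : sep (aff_mul g s) a = 1 - sep g a.
Proof.
by have [_ _ _ sa1 _] := sa; rewrite sepM// sa1 linE refl_self// sepN.
Qed.

(** Away from a and - a the terms of the length are permuted by s_a; only these two change. The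
    additive form avoids truncated subtraction. *)
Lemma len_wall2 g : ((len (aff_mul g s)).*2 + `|sep g a|.*2 =
  (len g).*2 + `|(sep g a - 1)%R|.*2)%N.
Proof.
rewrite !len_sep2.
have NaR : - a \in R0 by rewrite oppR.
have E h : (\sum_(c <- R0) h c = h a + h (- a) + \sum_(c <- R0 | (c != a) && (c != - a)) h c)%N.
  rewrite (bigD1_seq a)//= ?fset_uniq// -addnA; congr addn; rewrite -big_filter (bigD1_seq (- a))/=.
  - by rewrite big_filter_cond.
  - by rewrite mem_filter eq_sym aNa.
  - by rewrite filter_uniq// fset_uniq.
rewrite [in LHS]E [in RHS]E sep_wall_self !sepN// sep_wall_self.
rewrite !abszN.
have -> : (\sum_(c <- R0 | (c != a) && (c != - a)) `|sep (aff_mul g s) c| =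
   \sum_(c <- R0 | (c != a) && (c != - a)) `|sep g c|)%N.
  rewrite -[RHS](perm_big _ (perm_roots_refl aR))/= big_map big_seq_cond [RHS]big_seq_cond.
  apply: eq_big => [c|c /and3P[cR ca cNa]]; last by rewrite sep_wall.
  have Ea z : (refl a c == z) = (c == refl a z).
    by rewrite -[RHS](inj_eq (refl_inj aR)) reflK.
  congr (_ && _); rewrite !Ea -[in refl a (- a)](refl_self aR) reflK//.
  by rewrite refl_self// andbC.
lia.
Qed.

Lemma len_wall_down g : 0 < sep g a -> len g = (len (aff_mul g s)).+1.
Proof. by have := len_wall2 g; move: (sep g a) (len _) (len _) => x m n; lia. Qed.

Lemma len_wall_up g : sep g a <= 0 -> len (aff_mul g s) = (len g).+1.
Proof. by have := len_wall2 g; move: (sep g a) (len _) (len _) => x m n; lia. Qed.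

Lemma len_wall : len s = 1%N.
Proof. by rewrite -[s]aff_1mul len_wall_up ?sep1 ?len1. Qed.

End Wall.

(** An element that crosses no wall of the fundamental alcove fixes it. A positive coroot is a
    nonnegative combination of simple coroots, and a negative one is minus a highest coroot plus
    such a combination; so [sep] is nonpositive everywhere, and it is odd. *)
Lemma sep_le0_len0 g :
  (forall s a, s \in Saff D -> wall_refl s a -> sep g a <= 0) -> len g = 0%N.
Proof.
move=> H.
pose N a := pr g.1 (lin g *m a).
have Hs b : b \in F0 -> N b + (lin g *m b \notin pos)%:R <= 0.
  move=> bF; have bR := simple_root bF.
  have := H _ _ (Saff_simple bR bF) (wall_refl_finite (a := [` bR]%fset) bF).
  by rewrite /sep -/(N b) simple_pos//= subr0.
have prE x z : z \in R0 -> pr x (lin g *m z) = pr (invmx (lin g) *m x) z.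
  move=> zR; rewrite -(weyl_pr _ (lin_weyl g) zR) mulKVmx//.
  exact/weyl_unit/lin_weyl.
pose S x (c : 'cV[int]_r -> nat) := \sum_(i <- F0) pr x (lin g *m i) * (c i)%:Z.
have SE x (c : 'cV[int]_r -> nat) : pairing D (invmx (lin g) *m x) (\sum_(i <- F0) coroot D i *+ c i) = S x c.
  rewrite pairing_sumr; apply: eq_big_seq => i /simple_root iR.
  by rewrite pmulrn pairingZr prE.
have N0 i : i \in F0 -> N i <= 0.
  by move=> /Hs; case: (_ \in pos) => /= h; move: (N i) h => n; lia.
have S0 (c : 'cV[int]_r -> nat) : S g.1 c <= 0.
  rewrite /S big_seq; apply: sumr_le0 => i iF.
  by rewrite -/(N i); have := N0 i iF; move: (N i) => n; nia.
(* If the g-image of the combination has negative height, some simple i with nonzero coefficient has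
   a negative image, and [Hs] then gives N i <= -1. *)
have S1 (c : 'cV[int]_r -> nat) : S (rho2 D) c < 0 -> S g.1 c <= -1.
  move=> Sneg; have [i iF ni] : exists2 i, i \in F0 & ht D (coroot D (lin g *m i)) * (c i)%:Z < 0.
    apply/not_exists2P => K; move: Sneg; apply/negP; rewrite -leNgt /S big_seq.
    apply: sumr_ge0 => i iF; rewrite leNgt; apply/negP.
    by have [] := K i.
  have iR := simple_root iF.
  have wi : lin g *m i \notin pos.
    rewrite ht_neg ?lin_root//; move: (ht D _) ni => n; nia.
  have ci : (0 < c i)%N by rewrite lt0n; apply: contraTneq ni => ->; rewrite mulr0 ltxx.
  have := Hs i iF; rewrite wi /S (bigD1_seq i)//= ?fset_uniq// -/(N i) => Ni.
  set T := \sum_(_ <- _ | _) _.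
  have T0 : T <= 0.
    rewrite /T big_seq_cond; apply: sumr_le0 => j /andP[jF _].
    by rewrite -/(N j); have := N0 j jF; move: (N j) => n; nia.
  move: (N i) (T) T0 Ni => n t; nia.
have posle a : a \in pos -> sep g a <= 0.
  move=> aP; have aR := pos_root aP; rewrite /sep aP subr0.
  have [c cE] := nnc_coefs (nnc_pos aP).
  have e x : pr x (lin g *m a) = S x c by rewrite prE// cE SE.
  have := S0 c; have := S1 c; rewrite e.
  have [gaP|] := boolP (lin g *m a \in pos); first by rewrite addr0.
  rewrite ht_neg ?lin_root// /ht e => -> /(_ isT); move: (S _ _) => n; lia.
(* The affine wall bounds [sep] at - t; [S0] and [S1], applied to the difference of the coroots of t
   and a, carry the bound to - a. *)
have negle a : a \in pos -> sep g (- a) <= 0.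
  move=> aP; have aR := pos_root aP; have [t [tR tH [c' cE']]] := highest_above aR.
  have [c cE] : exists c : 'cV[int]_r -> nat, coroot D t - coroot D a = \sum_(b <- F0) coroot D b *+ c b.
    by apply: nnc_coefs; exists c'.
  have := H _ _ (Saff_highest tR tH) (wall_refl_affine (t := [` tR]%fset) tH).
  have tP := highest_pos tR tH.
  have e x : pr x (lin g *m t) = pr x (lin g *m a) + S x c.
    by rewrite !prE// -SE -cE pairingBr addrC subrK.
  rewrite /= !sepN// /sep tP aP !subr0 e.
  have := S0 c; have := S1 c; have := e (rho2 D).
  have gaR := lin_root g aR; have gtR := lin_root g tR.
  rewrite -/(ht D _) -/(ht D _).
  have [gaP|gaN] := boolP (lin g *m a \in pos); have [gtP|gtN] := boolP (lin g *m t \in pos);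
   rewrite /= ?mulr1n ?mulr0n;
   move: (gaR) (gtR) => /ht_pos + /ht_pos; rewrite ?(negbTE gaN) ?(negbTE gtN) ?gaP ?gtP;
   move: (ht D _) (ht D _) (S _ _) (S _ _) (pr _ _) => n1 n2 n3 n4 n5; lia.
apply: double_inj; rewrite len_sep2 big_seq big1// => a aR.
have [aP|] := boolP (a \in pos).
  have := posle a aP; have := negle a aP; rewrite sepN//; move: (sep g a) => n; lia.
rewrite -opp_posE// => NaP; have := posle _ NaP; have := negle _ NaP.
by rewrite opprK sepN//; move: (sep g a) => n; lia.
Qed.

Lemma exchange g : (0 < len g)%N ->
  exists s a, [/\ s \in Saff D, wall_refl s a & 0 < sep g a].
Proof.
move=> g0; apply: contrapT => H; move: g0; rewrite sep_le0_len0// => s a sS sa.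
by rewrite leNgt; apply/negP => ga; apply: H; exists s, a.
Qed.

End AffineReflections.

(** * Folds *)

Section Folds.
Local Open Scope ring_scope.
Variables (r : nat) (D : based_root_datum r).
Implicit Types (a b c x y : 'cV[int]_r) (g u v s : affweyl D).

Local Notation pr x a := (pairing D x (coroot D a)).
Local Notation R0 := (R0 D).
Local Notation refl := (refl D).
Local Notation pos := (pos_roots D).

Definition crossed u v := [seq a <- R0 | (0 < sep u a) && (0 < sep v a)].

(* [folds u (aff_inv v)] bounds the number of applications of the quadratic *)
(* relation in each branch of the expansion of N_u N_v.                     *)
Definition folds u v := size (crossed u v).

Lemma mem_crossed u v a :
  (a \in crossed u v) = [&& a \in R0, 0 < sep u a & 0 < sep v a].
Proof. by rewrite mem_filter andbC. Qed.

Lemma crossed_uniq u v : uniq (crossed u v).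
Proof. exact/filter_uniq/fset_uniq. Qed.

(** As [sep] is odd, at most one of a and - a is crossed. *)
Lemma folds_le_pos u v : (folds u v <= size pos)%N.
Proof.
pose h a := if a \in pos then a else - a.
have uh : uniq [seq h a | a <- crossed u v].
  rewrite map_inj_in_uniq ?crossed_uniq// => a b.
  rewrite !mem_crossed => /and3P[aR ua _] /and3P[bR ub _].
  rewrite /h; case: ifP => aP; case: ifP => bP // e.
  - by move: ua; rewrite e sepN//; lia.
  - by move: ub; rewrite -e sepN//; lia.
  - exact: oppr_inj.
rewrite /folds -(size_map h); apply: uniq_leq_size uh _ => _ /mapP[a + ->].
rewrite mem_crossed => /and3P[aR _ _]; rewrite /h.
by have [//|] := boolP (a \in pos); rewrite -opp_posE.
Qed.

Section Fold.
Variables (s : affweyl D) (a : 'cV[int]_r).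
Hypothesis sa : wall_refl s a.
Let aR : a \in R0. Proof. by case: sa. Qed.

Let sep_wallN g : sep (aff_mul g s) (- a) = sep g a - 1.
Proof. by rewrite sepN// (sep_wall_self sa) opprB. Qed.

(** s_a maps the crossed roots of (us, vs) injectively to those of (u, v). The exceptional root - a
    goes to a, where positivity for v is the hypothesis. *)
Lemma folds_wall u v : 0 < sep v a ->
  (folds (aff_mul u s) (aff_mul v s) <= folds u v)%N.
Proof.
move=> va; rewrite /folds -(size_map (refl a)); apply: uniq_leq_size.
  by rewrite (map_inj_uniq (refl_inj aR)) crossed_uniq.
move=> _ /mapP[c + ->]; rewrite !mem_crossed => /and3P[cR uc vc].
rewrite refl_root//=.
have ca : c != a by apply: contraTneq vc => ->; rewrite (sep_wall_self sa); lia.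
have [cNa|cNa] := eqVneq c (- a).
  have -> : refl a c = a by rewrite cNa -(refl_self aR) reflK.
  by move: uc; rewrite cNa sep_wallN va; lia.
by rewrite -!(sep_wall sa)// uc.
Qed.

(** Here only v is moved, so neither c nor s_a c need be crossed a priori; closedness for u and v
    shows that one of them always is. The root a is crossed and is never reached. *)
Lemma folds_lt u v : 0 < sep u a -> 0 < sep v a ->
  (folds u (aff_mul v s) < folds u v)%N.
Proof.
move=> ua va.
have src c : c \in crossed u (aff_mul v s) ->
    [/\ c \in R0, c != a, c != - a, 0 < sep u c & 0 < sep v (refl a c)].
  rewrite mem_crossed => /and3P[cR uc vc].
  have ca : c != a by apply: contraTneq vc => ->; rewrite (sep_wall_self sa); lia.
  have cNa : c != - a by apply: contraTneq uc => ->; rewrite sepN//; lia.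
  by split=> //; rewrite -(sep_wall sa).
(* h is injective and its image misses a. *)
pose h c := if 0 < sep v c then c else refl a c.
have uh : uniq [seq h c | c <- crossed u (aff_mul v s)].
  rewrite map_inj_in_uniq ?crossed_uniq// => c d /src[cR _ _ _ vc] /src[dR _ _ _ vd].
  rewrite /h; case: ifPn => cP; case: ifPn => dP // e.
  - by rewrite -[d](reflK aR) -e vc in dP.
  - by rewrite -[c](reflK aR) e vd in cP.
  - exact: refl_inj e.
have ah : a \notin [seq h c | c <- crossed u (aff_mul v s)].
  apply/mapP => -[c /src[cR ca cNa _ _]]; rewrite /h; case: ifP => _.
    by move=> e; rewrite e eqxx in ca.
  move/(congr1 (refl a)); rewrite reflK// refl_self// => e.
  by rewrite e eqxx in cNa.
have : uniq (a :: [seq h c | c <- crossed u (aff_mul v s)]) by rewrite /= ah.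
move/uniq_leq_size => /(_ (crossed u v)); rewrite /= size_map; apply.
move=> x; rewrite in_cons => /predU1P[->|/mapP[c /src[cR ca cNa uc vc] ->]].
  by rewrite mem_crossed aR ua.
rewrite /h mem_crossed; case: ifPn => vc'; first by rewrite cR uc.
(* If a pairs nonpositively with c, closedness for u applies. Otherwise it pairs negatively with s_a
   c, and closedness for v would give 0 < [sep v c]. *)
rewrite refl_root// vc andbT/= sep_closed//.
rewrite leNgt; apply/negP => ac; move/negP: vc'; apply.
rewrite -(reflK aR c); apply: sep_closed => //; first exact: refl_root.
by rewrite pr_reflr// refl_self// pairingNl oppr_le0 ltW.
Qed.

End Fold.
End Folds.

(** * Weighted norms *)

Section CalN.
Local Open Scope ring_scope.
Variables (R : realType) (r : nat) (D : based_root_datum r).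
Variable f : 'cV[R]_r -> R.
Hypothesis hf : is_central_norm D f.
Implicit Types (a x y : 'cV[int]_r) (u v s : affweyl D).

Local Notation R0 := (R0 D).
Local Notation lin g := (val (snd g)).

Lemma to_realD x y : to_real R (x + y) = to_real R x + to_real R y.
Proof. exact: map_mxD. Qed.

Lemma in_QR_root a (k : int) : a \in R0 -> in_QR D (to_real R (a *~ k)).
Proof.
move=> aR; exists (fun x => (x == a)%:R * k%:~R).
rewrite (bigD1_seq a)//= ?fset_uniq// eqxx mul1r big1 ?addr0 => [|x /negbTE ->].
  by rewrite /to_real -scaler_int intz map_mxZ.
by rewrite mul0r scale0r.
Qed.

Lemma central_add_root x a (k : int) : a \in R0 ->
  f (to_real R (x + a *~ k)) = f (to_real R x).
Proof. by move=> aR; rewrite to_realD; have [_ fQ _ _] := hf; apply/fQ/in_QR_root. Qed.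

Lemma central_ge0 (x : 'cV[R]_r) : 0 <= f x. Proof. by case: hf. Qed.

Lemma central0 : f 0 = 0.
Proof. by have [_ _ _ [_ fZ _]] := hf; rewrite -(scale0r 0) fZ normr0 mul0r. Qed.

(** A reflection changes x by a multiple of a root, which f does not see. *)
Lemma central_weyl A x : in_weyl D A -> f (to_real R (A *m x)) = f (to_real R x).
Proof.
elim=> [|a B aR _ IH]; first by rewrite mul1mx.
by rewrite -mulmxA refl_mxE /Defs.refl -mulrNz central_add_root.
Qed.

Lemma calNE u : calN f u = (len u)%:R + f (to_real R u.1).
Proof. by rewrite /calN /aff_act mulmx0 addr0. Qed.

Lemma calN_ge0 u : 0 <= calN f u.
Proof. by rewrite addr_ge0 ?central_ge0. Qed.

Lemma calN_wall u s a : wall_refl s a ->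
  f (to_real R (aff_mul u s).1) = f (to_real R u.1).
Proof.
case=> aR _ [k sE] _ _; rewrite /= sE mulmxMz central_add_root//.
exact: lin_root.
Qed.

Lemma calN_wall_left v s a : wall_refl s a ->
  f (to_real R (aff_mul s v).1) = f (to_real R v.1).
Proof.
case=> aR sl [k sE] _ _; rewrite /= sE sl refl_mxE addrC /Defs.refl.
by rewrite -mulrNz !central_add_root.
Qed.

Lemma calN_mul0 u v : len v = 0%N -> calN f (aff_mul u v) <= calN f u + calN f v.
Proof.
move=> v0; rewrite !calNE len_mul0// v0 add0r -addrA lerD2l /= to_realD.
have [_ _ _ [fD _ _]] := hf; rewrite (le_trans (fD _ _))// central_weyl//.
exact: lin_weyl.
Qed.

Lemma calN1 : calN f (aff_one D) = 0.
Proof. by rewrite calNE len1 add0r /= /to_real map_mx0 central0. Qed.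

Lemma len_calN u : (len u)%:R <= calN f u.
Proof. by rewrite lerDl central_ge0. Qed.

End CalN.

Section WeightedL1.
Local Open Scope ring_scope.
Variables (R : realType) (r : nat) (D : based_root_datum r).
Variable f : 'cV[R]_r -> R.
Hypothesis hf : is_central_norm D f.
Implicit Types (u v w : affweyl D) (x y : hseries R D) (n : nat) (K : R).

Local Notation normc := (@Normc.normc R).
Local Notation wt w := (calN f w + 1).

Lemma normc_ge0 (z : R[i]) : 0 <= normc z.
Proof. by case: z => a b; apply: sqrtr_ge0. Qed.

Lemma normcD_le (z1 z2 : R[i]) : normc (z1 + z2) <= normc z1 + normc z2.
Proof. exact: le_normcD. Qed.

Lemma normc_real (c : R) : normc c%:C%C = `|c|.
Proof. by rewrite /Normc.normc /= expr0n addr0 sqrtr_sqr. Qed.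

Lemma wt_ge1 w : 1 <= wt w.
Proof. by rewrite lerDr calN_ge0. Qed.

Lemma wt_ge0 w : 0 <= wt w.
Proof. exact: le_trans (wt_ge1 w). Qed.

(** The weighted l^1 norm |x|_n is at most K. Bounding finite partial sums avoids any summability
    condition. *)
Definition l1_le n x K := forall B : seq (affweyl D), uniq B ->
  \sum_(w <- B) normc (x w) * wt w ^+ n <= K.

Lemma l1_le_ge0 n x K : l1_le n x K -> 0 <= K.
Proof. by move/(_ [::] isT); rewrite big_nil. Qed.

Lemma l1_le_trans n x K K' : K <= K' -> l1_le n x K -> l1_le n x K'.
Proof. by move=> KK' xK B uB; apply: le_trans KK'; apply: xK. Qed.

Lemma l1_leD n x y K L : l1_le n x K -> l1_le n y L -> l1_le n (x + y) (K + L).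
Proof.
move=> xK yL B uB; apply: le_trans (lerD (xK B uB) (yL B uB)).
rewrite -big_split/=; apply: ler_sum => w _; rewrite -mulrDl.
by apply: ler_wpM2r; rewrite ?exprn_ge0 ?wt_ge0// normcD_le.
Qed.

Lemma l1_leZ n c x K : l1_le n x K -> l1_le n (hscale c x) (normc c * K).
Proof.
move=> xK B uB; apply: le_trans (ler_wpM2l (normc_ge0 c) (xK B uB)).
by rewrite mulr_sumr; apply: ler_sum => w _; rewrite Normc.normcM mulrA.
Qed.

Lemma l1_le0 n : l1_le n 0 0.
Proof.
by move=> B _; rewrite big1// => w _; rewrite [X in normc X]/(0 : R[i]) Normc.normc0 mul0r.
Qed.

Lemma l1_le_sum n (I : Type) (s : seq I) (F : I -> hseries R D) (K : I -> R) :
  (forall i, l1_le n (F i) (K i)) ->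
  l1_le n (\sum_(i <- s) F i) (\sum_(i <- s) K i).
Proof.
move=> H; elim: s => [|i s IH]; first by rewrite !big_nil; apply: l1_le0.
by rewrite !big_cons; apply: l1_leD.
Qed.

Lemma l1_le_Nbasis n w : l1_le n (Nbasis R w) (wt w ^+ n).
Proof.
move=> B uB; have [wB|wB] := boolP (w \in B); last first.
  rewrite big_seq big1 ?exprn_ge0 ?wt_ge0// => v vB.
  by rewrite /Nbasis (negbTE (memPn wB v vB)) Normc.normc0 mul0r.
rewrite (bigD1_seq w)//= big1 => [|v /negbTE vw]; last first.
  by rewrite /Nbasis vw Normc.normc0 mul0r.
by rewrite addr0 /Nbasis eqxx Normc.normc1 mul1r.
Qed.

Lemma l1_le_coef n x K w : l1_le n x K -> normc (x w) * wt w ^+ n <= K.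
Proof. by move/(_ [:: w] isT); rewrite big_seq1. Qed.

End WeightedL1.

(** * Bilinear products on finitely supported series *)

Section Bilinear.
Local Notation finsupp := Defs.finsupp.
Local Open Scope ring_scope.
Variables (R : realType) (r : nat) (D : based_root_datum r).
Implicit Types (u v w : affweyl D) (x y : hseries R D).

Lemma hscale1 x : hscale 1 x = x.
Proof. by apply/funext => w; rewrite /hscale mul1r. Qed.

Lemma hscale0 (c : R[i]) : hscale c (0 : hseries R D) = 0.
Proof. by apply/funext => w; rewrite /hscale mulr0. Qed.

Lemma hscaleA (a b : R[i]) x : hscale a (hscale b x) = hscale (a * b) x.
Proof. by apply/funext => w; rewrite /hscale mulrA. Qed.

Lemma hscaleD (a : R[i]) x y : hscale a (x + y) = hscale a x + hscale a y.
Proof. by apply/funext => w; rewrite /hscale -mulrDr. Qed.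

Lemma hscale_inj (a : R[i]) : a != 0 -> injective (@hscale R r D a).
Proof.
move=> a0 x y /(congr1 (hscale a^-1)).
by rewrite !hscaleA mulVf// !hscale1.
Qed.

Lemma hscaleN x : hscale (-1) x = - x.
Proof. by apply/funext => w; rewrite /hscale mulN1r. Qed.

Lemma finsupp_zero : finsupp (0 : hseries R D).
Proof.
apply: (sub_finite_set _ (@finite_set0 _)) => w /=.
by rewrite [X in X != _]/(0 : R[i]) eqxx.
Qed.

Lemma finsuppD x y : finsupp x -> finsupp y -> finsupp (x + y).
Proof.
move=> fx fy; apply: (@sub_finite_set _ _ ([set w | x w != 0] `|` [set w | y w != 0])%classic).
  move=> w /= xy; have [x0|] := eqVneq (x w) 0; [right|by left].
  by apply: contraNN xy => /eqP y0; apply/eqP; rewrite -[LHS]/(x w + y w) x0 y0; exact: addr0.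
by rewrite finite_setU.
Qed.

Lemma finsuppZ (c : R[i]) x : finsupp x -> finsupp (hscale c x).
Proof.
apply: sub_finite_set => w /=; apply: contraNN => /eqP xw.
by rewrite /hscale xw mulr0.
Qed.

Lemma finsuppB x y : finsupp x -> finsupp y -> finsupp (x - y).
Proof. by move=> fx fy; rewrite -hscaleN; apply/finsuppD/finsuppZ. Qed.

Lemma finsupp_Nbasis w : finsupp (Nbasis R w).
Proof.
apply: (sub_finite_set _ (finite_set1 w)) => v /=; rewrite /Nbasis.
by apply: contraNeq => /negbTE ->.
Qed.

Lemma finsupp_sum (s : seq (affweyl D)) (F : affweyl D -> hseries R D) :
  (forall u, finsupp (F u)) -> finsupp (\sum_(u <- s) F u).
Proof.
move=> H; elim: s => [|u s IH]; first by rewrite big_nil; apply: finsupp_zero.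
by rewrite big_cons; apply: finsuppD.
Qed.

Lemma finsupp_sumE x : finsupp x -> exists2 s : seq (affweyl D), uniq s &
  x = \sum_(u <- s) hscale (x u) (Nbasis R u).
Proof.
move=> fx; exists (fset_set [set w | x w != 0]%classic); first exact: fset_uniq.
apply/funext => w.
have sumE (s : seq (affweyl D)) (F : affweyl D -> hseries R D) :
    (\sum_(u <- s) F u) w = \sum_(u <- s) F u w.
  by elim: s => [|u s IH]; rewrite ?big_nil// !big_cons -IH.
rewrite sumE; have [xw0|xw] := eqVneq (x w) 0.
  rewrite big1// => u _; rewrite /hscale /Nbasis.
  by case: eqVneq => [<-|_]; rewrite ?xw0 ?mul0r// mulr0.
rewrite (bigD1_seq w)//= ?fset_uniq//; last by rewrite in_fset_set// inE.
rewrite big1 => [|u uw]; last by rewrite /hscale /Nbasis eq_sym (negbTE uw) mulr0.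
by rewrite addr0 /hscale /Nbasis eqxx mulr1.
Qed.

Definition bilinear_fin (op : hseries R D -> hseries R D -> hseries R D) :=
  (forall c x x' y, finsupp x -> finsupp x' -> finsupp y ->
     op (hscale c x + x') y = hscale c (op x y) + op x' y) /\
  (forall c x y y', finsupp x -> finsupp y -> finsupp y' ->
     op x (hscale c y + y') = hscale c (op x y) + op x y').

Variable op : hseries R D -> hseries R D -> hseries R D.
Hypothesis opbil : bilinear_fin op.

Lemma op0l y : finsupp y -> op 0 y = 0.
Proof.
move=> fy; have := opbil.1 1 0 0 y finsupp_zero finsupp_zero fy.
by rewrite hscale0 addr0 hscale1 => /eqP; rewrite -subr_eq subrr => /eqP.
Qed.

Lemma op0r x : finsupp x -> op x 0 = 0.
Proof.
move=> fx; have := opbil.2 1 x 0 0 fx finsupp_zero finsupp_zero.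
by rewrite hscale0 addr0 hscale1 => /eqP; rewrite -subr_eq subrr => /eqP.
Qed.

Lemma opZl c x y : finsupp x -> finsupp y -> op (hscale c x) y = hscale c (op x y).
Proof.
by move=> fx fy; rewrite -[hscale c x]addr0 opbil.1 ?op0l ?addr0//; apply: finsupp_zero.
Qed.

Lemma opZr c x y : finsupp x -> finsupp y -> op x (hscale c y) = hscale c (op x y).
Proof.
by move=> fx fy; rewrite -[hscale c y]addr0 opbil.2 ?op0r ?addr0//; apply: finsupp_zero.
Qed.

Lemma opDl x x' y : finsupp x -> finsupp x' -> finsupp y ->
  op (x + x') y = op x y + op x' y.
Proof. by move=> fx fx' fy; rewrite -{1}[x]hscale1 opbil.1// hscale1. Qed.

Lemma opDr x y y' : finsupp x -> finsupp y -> finsupp y' ->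
  op x (y + y') = op x y + op x y'.
Proof. by move=> fx fy fy'; rewrite -{1}[y]hscale1 opbil.2// hscale1. Qed.

Lemma opBl x x' y : finsupp x -> finsupp x' -> finsupp y ->
  op (x - x') y = op x y - op x' y.
Proof.
move=> fx fx' fy; rewrite -!hscaleN opDl ?opZl//; exact: finsuppZ.
Qed.

Lemma opBr x y y' : finsupp x -> finsupp y -> finsupp y' ->
  op x (y - y') = op x y - op x y'.
Proof.
move=> fx fy fy'; rewrite -!hscaleN opDr ?opZr//; exact: finsuppZ.
Qed.

Lemma op_sum (s t : seq (affweyl D)) (c d : affweyl D -> R[i]) :
  op (\sum_(u <- s) hscale (c u) (Nbasis R u)) (\sum_(v <- t) hscale (d v) (Nbasis R v)) =
  \sum_(u <- s) \sum_(v <- t) hscale (c u * d v) (op (Nbasis R u) (Nbasis R v)).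
Proof.
have fN := finsupp_Nbasis; have fT (e : affweyl D -> R[i]) s' :
   finsupp (\sum_(v <- s') hscale (e v) (Nbasis R v)).
  by apply: finsupp_sum => v; apply: finsuppZ.
elim: s => [|u s IH]; first by rewrite !big_nil op0l.
rewrite !big_cons opbil.1// IH; congr (_ + _).
elim: t {IH} => [|v t IH]; first by rewrite !big_nil op0r// hscale0.
by rewrite !big_cons opbil.2// hscaleD IH hscaleA.
Qed.

(** The weight of the pair (u, v) is at most the product of the two weights, and len v + 1 is at
    most the weight of v. So the N powers of the length are paid by the right factor. *)
Lemma bilinear_l1_le (f : 'cV[R]_r -> R) (K : R) (n N : nat) x y Kx Ky :
  is_central_norm D f -> 0 <= K ->
  (forall u v, l1_le f n (op (Nbasis R u) (Nbasis R v))
     (K * (len v).+1%:R ^+ N * (calN f u + calN f v + 1) ^+ n)) ->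
  finsupp x -> finsupp y -> l1_le f n x Kx -> l1_le f (n + N) y Ky ->
  l1_le f n (op x y) (K * Kx * Ky).
Proof.
move=> hf K0 H fx fy xK yK.
have [s us xE] := finsupp_sumE fx; have [t ut yE] := finsupp_sumE fy.
rewrite xE yE op_sum.
apply: (l1_le_trans _ (l1_le_sum hf s (fun u => l1_le_sum hf t (fun v => l1_leZ (x u * y v) (H u v))))).
have Kx0 := l1_le_ge0 xK.
apply: le_trans (ler_wpM2l (mulr_ge0 K0 Kx0) (yK t ut)).
apply: (@le_trans _ _ (K * (\sum_(u <- s) Normc.normc (x u) * (calN f u + 1) ^+ n) *
   (\sum_(w <- t) Normc.normc (y w) * (calN f w + 1) ^+ (n + N)))); last first.
  apply: ler_wpM2r; last exact/ler_wpM2l/xK.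
  by apply: sumr_ge0 => w _; rewrite mulr_ge0 ?normc_ge0 ?exprn_ge0 ?wt_ge0.
rewrite -mulrA mulr_suml mulr_sumr; apply: ler_sum => u _.
rewrite mulr_sumr mulr_sumr; apply: ler_sum => v _.
rewrite Normc.normcM exprD.
have u0 := calN_ge0 hf u; have v0 := calN_ge0 hf v.
have lv : (len v).+1%:R <= calN f v + 1 by rewrite -natr1 lerD2r len_calN.
rewrite [leRHS](_ : _ = Normc.normc (x u) * Normc.normc (y v) * (K *
   (calN f v + 1) ^+ N * ((calN f u + 1) * (calN f v + 1)) ^+ n)); last first.
  by rewrite exprMn; ring.
apply: ler_wpM2l; first by rewrite mulr_ge0 ?normc_ge0.
move: (calN f u) (calN f v) u0 v0 lv => U V U0 V0 lv.
apply: ler_pM; rewrite ?mulr_ge0 ?exprn_ge0 ?addr_ge0//.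
  by apply: ler_wpM2l => //; rewrite lerXn2r// nnegrE// addr_ge0.
by rewrite lerXn2r// ?nnegrE ?addr_ge0 ?mulr_ge0 ?addr_ge0//; nra.
Qed.

End Bilinear.

(** * Structure constants of the Hecke algebra *)

Section FoldArithmetic.
Local Open Scope ring_scope.
Variables (R : realType) (M : R).
Hypothesis M1 : 1 <= M.

(** With at most p folds along a word of l letters there are at most (l + 1)^p branches, each with
    coefficient at most M^p. *)
Definition fold_bound (p l : nat) : R := M ^+ p * l.+1%:R ^+ p.

(* Multiplied by rho(q, q'), this bounds the variation of the structure      *)
(* constants between q and q'; without folds (p = 0) they do not vary.       *)
Definition fold_var (p l : nat) : R := if p is 0 then 0 else M ^+ p * l%:R ^+ p.

Let M0 : 0 <= M. Proof. exact: le_trans M1. Qed.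

Lemma fold_bound_ge0 p l : 0 <= fold_bound p l.
Proof. by rewrite mulr_ge0// exprn_ge0. Qed.

Lemma fold_bound_S p l : fold_bound p l <= fold_bound p l.+1.
Proof. by rewrite ler_wpM2l ?exprn_ge0// lerXn2r ?nnegrE// ler_nat. Qed.

(** The two summands are the two branches of [hecke_fold]: one keeps the fold budget, the other pays
    one fold and a factor M. *)
Lemma fold_bound_fold p l :
  fold_bound p.+1 l + M * fold_bound p l <= fold_bound p.+1 l.+1.
Proof.
rewrite /fold_bound mulrA -exprS -mulrDr ler_wpM2l ?exprn_ge0//.
rewrite exprSr -[X in _ + X]mulr1 -mulrDr natr1 [leRHS]exprSr.
by apply: ler_wpM2r => //; rewrite lerXn2r ?nnegrE// ler_nat.
Qed.

Lemma fold_var_S p l : fold_var p l <= fold_var p l.+1.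
Proof.
by case: p => // p; rewrite ler_wpM2l ?exprn_ge0// lerXn2r ?nnegrE// ler_nat.
Qed.

Lemma fold_var_le_bound p l : fold_var p l <= fold_bound p l.
Proof.
case: p => [|p]; first exact: fold_bound_ge0.
by rewrite ler_wpM2l ?exprn_ge0// lerXn2r ?nnegrE// ler_nat.
Qed.

Lemma fold_var_fold p l :
  fold_var p.+1 l + M * fold_var p l + fold_bound p l <= fold_var p.+1 l.+1.
Proof.
have MM k : M ^+ k <= M ^+ k.+1 by rewrite ler_weXn2l.
case: p => [|p].
  rewrite /= /fold_bound !expr1 !expr0 mulr0 addr0 !mul1r -natr1 mulrDr mulr1.
  by rewrite lerD2l.
rewrite /fold_var /fold_bound mulrA -exprS.
apply: (@le_trans _ _ (M ^+ p.+2 * (l%:R ^+ p.+2 + l%:R ^+ p.+1 + l.+1%:R ^+ p.+1))).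
  rewrite !mulrDr lerD2l; apply: ler_wpM2r; first exact: exprn_ge0.
  exact: MM.
apply: ler_wpM2l; first exact: exprn_ge0.
have AB : l.+1%:R = l%:R + 1 :> R by rewrite natr1.
have B0 : 0 <= l.+1%:R :> R by [].
have A0 : 0 <= l%:R :> R by [].
have AB_le : l%:R ^+ p <= l.+1%:R ^+ p :> R by rewrite lerXn2r ?nnegrE// ler_nat.
(* With B = l + 1 and B^(p+2) = l B^(p+1) + B^(p+1), what remains is l^(p+1) B <= l B^(p+1). *)
have := ler_wpM2l (mulr_ge0 A0 B0) AB_le.
by rewrite !(exprS _ p) !(exprS _ p.+1) !(exprS _ p) AB; nra.
Qed.

End FoldArithmetic.

Section HeckeProduct.
Local Open Scope ring_scope.
Local Notation finsupp := Defs.finsupp.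
Variables (R : realType) (r : nat) (D : based_root_datum r).
Variables (q : affweyl D -> R) (mul : hseries R D -> hseries R D -> hseries R D).
Hypotheses (hq : is_label q) (hmul : is_hecke_mul q mul).
Implicit Types (u v w s : affweyl D) (x y : hseries R D) (a : 'cV[int]_r).

Local Notation N := (@Nbasis R r D).
Local Notation sq w := ((Num.sqrt (q w))%:C%C : R[i]).

Lemma hecke_bilinear : bilinear_fin mul.
Proof. by split; [exact: hecke_linl hmul|exact: hecke_linr hmul]. Qed.

Let bil := hecke_bilinear.
Let fN := @finsupp_Nbasis R r D.

Lemma q_gt0 w : 0 < q w. Proof. by case: hq. Qed.

Lemma sq_neq0 w : sq w != 0.
Proof.
by rewrite -[0]/((0 : R)%:C%C) (inj_eq (@complexI _)) gt_eqF// sqrtr_gt0 q_gt0.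
Qed.

Lemma hecke_Nmul u v : len (aff_mul u v) = (len u + len v)%N ->
  mul (N u) (N v) = N (aff_mul u v).
Proof.
move=> luv; have := hecke_mulT hmul luv; rewrite /Tbasis.
have [_ _ qM] := hq; rewrite (opZl bil) ?(opZr bil)//; try exact: finsuppZ.
rewrite hscaleA -rmorphM/= qM// sqrtrM ?(ltW (q_gt0 _))//.
by rewrite rmorphM/=; apply: hscale_inj; rewrite mulf_neq0 ?sq_neq0.
Qed.

Lemma hecke_Nquad s : s \in Saff D ->
  mul (N s) (N s) = hscale (eta_label q s)%:C%C (N s) + N (aff_one D).
Proof.
move=> sS; have := hecke_quad hmul sS; rewrite /Tbasis.
have [_ q1 _] := hq; rewrite (q1 (aff_one D)) ?len1// sqrtr1.
rewrite (opZl bil) ?(opZr bil)//; try exact: finsuppZ.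
have s0 : 0 < Num.sqrt (q s) by rewrite sqrtr_gt0 q_gt0.
rewrite !hscaleA -!rmorphM/= mulr1 -expr2 sqr_sqrtr ?(ltW (q_gt0 _))//.
have qs0 : (q s)%:C%C != 0 :> R[i].
  by rewrite -[0]/((0 : R)%:C%C) (inj_eq (@complexI _)) gt_eqF// q_gt0.
move=> e; apply: (hscale_inj qs0); rewrite e hscaleD hscaleA -rmorphM/=.
congr (hscale _%:C%C _ + _); rewrite /eta_label.
move: (Num.sqrt (q s)) s0 (esym (sqr_sqrtr (ltW (q_gt0 s)))) => t t0 ->.
by field; apply: lt0r_neq0.
Qed.

(** Positivity of [sep] at the inverse of v says that s is a left descent of v, so lengths add in v
    = s (s v). *)
Let Nsplit s a v : wall_refl s a -> 0 < sep (aff_inv v) a ->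
  N v = mul (N s) (N (aff_mul s v)).
Proof.
move=> sa va; rewrite hecke_Nmul.
  by rewrite aff_mulA (wall_invol sa) aff_1mul.
rewrite aff_mulA (wall_invol sa) aff_1mul (len_wall sa) add1n.
by rewrite -(len_inv v) (len_wall_down sa va) -(len_inv (aff_mul s v)) (aff_invM s v) (wall_inv sa).
Qed.

Lemma hecke_straight u v s a : wall_refl s a -> sep u a <= 0 ->
  0 < sep (aff_inv v) a ->
  mul (N u) (N v) = mul (N (aff_mul u s)) (N (aff_mul s v)).
Proof.
move=> sa ua va; apply: etrans (congr1 (mul (N u)) (Nsplit sa va)) _.
apply: etrans (heckeA hmul (fN u) (fN s) (fN _)) _; congr (mul _ _).
by apply: hecke_Nmul; rewrite (len_wall_up sa ua) (len_wall sa) addn1.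
Qed.

(** Now us is shorter than u, so N_u = N_us N_s, and the quadratic relation gives N_u N_s = eta_s
    N_u + N_us. *)
Lemma hecke_fold u v s a : s \in Saff D -> wall_refl s a -> 0 < sep u a ->
  0 < sep (aff_inv v) a ->
  mul (N u) (N v) = hscale (eta_label q s)%:C%C (mul (N u) (N (aff_mul s v))) +
                    mul (N (aff_mul u s)) (N (aff_mul s v)).
Proof.
move=> sS sa ua va.
have uE : N u = mul (N (aff_mul u s)) (N s).
  rewrite hecke_Nmul (wall_mulK sa)// (len_wall_down sa ua).
  by rewrite (len_wall sa) addn1.
have uN1 : mul (N (aff_mul u s)) (N (aff_one D)) = N (aff_mul u s).
  by rewrite hecke_Nmul aff_mul1// len1 addn0.
have usE : mul (N u) (N s) = hscale (eta_label q s)%:C%C (N u) + N (aff_mul u s).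
  apply: etrans (congr1 (mul^~ (N s)) uE) _.
  apply: etrans (esym (heckeA hmul (fN _) (fN s) (fN s))) _.
  apply: etrans (congr1 (mul _) (hecke_Nquad sS)) _.
  apply: etrans (bil.2 _ _ _ _ (fN _) (fN s) (fN _)) _.
  apply: (congr2 (fun x y => hscale _ x + y) (esym uE) uN1).
apply: etrans (congr1 (mul (N u)) (Nsplit sa va)) _.
apply: etrans (heckeA hmul (fN u) (fN s) (fN _)) _.
apply: etrans (congr1 (mul^~ _) usE) _.
exact: (bil.1 _ _ _ _ (fN u) (fN _) (fN _)).
Qed.

End HeckeProduct.

(** * Norms of the products of basis elements *)

Section StructureConstants.
Local Open Scope ring_scope.
Local Notation finsupp := Defs.finsupp.
Variables (R : realType) (r : nat) (D : based_root_datum r).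
Variables (f : 'cV[R]_r -> R) (hf : is_central_norm D f).
Implicit Types (u v w s : affweyl D).

Local Notation N := (@Nbasis R r D).

(** Passing from v to sv loses one letter, us gains at most one, and f is unchanged by both
    moves. *)
Lemma calN_descent u v s (a : 'cV[int]_r) :
  wall_refl s a -> 0 < sep (aff_inv v) a ->
  [/\ calN f (aff_mul s v) <= calN f v,
      calN f (aff_mul u s) + calN f (aff_mul s v) <= calN f u + calN f v &
      len v = (len (aff_mul s v)).+1].
Proof.
move=> sa va.
have lv : len v = (len (aff_mul s v)).+1.
  rewrite -(len_inv v) (len_wall_down sa va) -(len_inv (aff_mul s v)).
  by rewrite aff_invM (wall_inv sa).
rewrite !calNE (calN_wall hf u sa) (calN_wall_left hf v sa) lv.
have [ua|ua] := leP (sep u a) 0.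
  rewrite (len_wall_up sa ua) -!natr1; split=> //; lra.
rewrite [len u](len_wall_down sa ua) -!natr1; split=> //; lra.
Qed.

Let wsum_ge0 u v : 0 <= calN f u + calN f v + 1.
Proof. by rewrite (le_trans ler01)// lerDr (addr_ge0 (calN_ge0 hf u)) ?calN_ge0. Qed.

Let wpow_ge0 n u v : 0 <= (calN f u + calN f v + 1) ^+ n.
Proof. by rewrite exprn_ge0. Qed.

Let wpow_le n u v u' v' : calN f u + calN f v <= calN f u' + calN f v' ->
  (calN f u + calN f v + 1) ^+ n <= (calN f u' + calN f v' + 1) ^+ n.
Proof. by move=> h; rewrite lerXn2r ?nnegrE// lerD2r. Qed.

Let fold_step l u v : len v = l.+1 -> exists s (a : 'cV[int]_r),
  [/\ s \in Saff D, wall_refl s a, 0 < sep (aff_inv v) a,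
      aff_inv (aff_mul s v) = aff_mul (aff_inv v) s &
      [/\ forall n, (calN f u + calN f (aff_mul s v) + 1) ^+ n <=
                    (calN f u + calN f v + 1) ^+ n,
          forall n, (calN f (aff_mul u s) + calN f (aff_mul s v) + 1) ^+ n <=
                    (calN f u + calN f v + 1) ^+ n &
          len (aff_mul s v) = l]].
Proof.
move=> lv; have [|s [a [sS sa va]]] := @exchange _ _ (aff_inv v).
  by rewrite len_inv lv.
have [h1 h2 h3] := calN_descent u sa va; exists s, a; split=> //.
  by rewrite aff_invM (wall_inv sa).
split=> [n|n|]; last by move: h3; rewrite lv => -[].
  by apply: wpow_le; rewrite lerD2l.
exact: wpow_le.
Qed.

Variable M : R.
Hypothesis M1 : 1 <= M.

(** Induction on the length of v, with p as fold budget. A straight step keeps p; in a fold the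
    branch that retains u has the smaller budget, by [folds_lt]. *)
Lemma Nmul_l1_le (q : affweyl D -> R) (mul : hseries R D -> hseries R D -> hseries R D)
  (hq : is_label q) (hmul : is_hecke_mul q mul)
  (hM : forall s, s \in Saff D -> `|eta_label q s| <= M) n l u v p : len v = l -> (folds u (aff_inv v) <= p)%N ->
  l1_le f n (mul (N u) (N v))
    (fold_bound M p l * (calN f u + calN f v + 1) ^+ n).
Proof.
elim: l u v p => [|l IH] u v p lv fp.
  rewrite (hecke_Nmul hq hmul); last by rewrite len_mul0// lv addn0.
  apply: (l1_le_trans _ (l1_le_Nbasis hf n _)).
  rewrite /fold_bound expr1n mulr1.
  apply: (@le_trans _ _ ((calN f u + calN f v + 1) ^+ n)).
    by rewrite lerXn2r ?nnegrE ?(wt_ge0 hf)// lerD2r calN_mul0.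
  by rewrite ler_peMl// exprn_ege1.
have [s [a [sS sa va vs [wle wdle lsv]]]] := fold_step u lv.
have [ua|ua] := leP (sep u a) 0.
  rewrite (hecke_straight hq hmul sa ua va).
  apply: (l1_le_trans _ (IH _ _ p lsv _)); last first.
    by rewrite vs; apply: leq_trans (folds_wall sa u va) fp.
  by apply: ler_pM (wdle n); rewrite ?fold_bound_ge0 ?fold_bound_S ?wpow_ge0.
(* A fold strictly lowers [folds], so p is a successor. *)
have := leq_trans (folds_lt sa ua va) fp; case: p fp => // p fp; rewrite ltnS -vs => fp'.
rewrite (hecke_fold hq hmul sS sa ua va).
apply: (l1_le_trans _ (l1_leD hf (l1_leZ _ (IH _ _ p lsv fp')) (IH _ _ p.+1 lsv _))); last first.
  by rewrite vs; apply: leq_trans (folds_wall sa u va) fp.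
rewrite normc_real; apply: le_trans (ler_wpM2r (wpow_ge0 n u v) (fold_bound_fold M1 p l)).
rewrite mulrDl addrC lerD//; first by rewrite ler_wpM2l ?fold_bound_ge0.
have b0 := fold_bound_ge0 M1 p l.
rewrite mulrA; apply: ler_pM (wle n) => //; first exact: mulr_ge0.
exact/ler_wpM2r/hM.
Qed.

Variables (q q' : affweyl D -> R) (mul mul' : hseries R D -> hseries R D -> hseries R D).
Hypotheses (hq : is_label q) (hmul : is_hecke_mul q mul).
Hypotheses (hq' : is_label q') (hmul' : is_hecke_mul q' mul').
Hypothesis hM : forall s, s \in Saff D -> `|eta_label q s| <= M.
Hypothesis hM' : forall s, s \in Saff D -> `|eta_label q' s| <= M.

Lemma sub_prod_split (T : comRingType) (e e' a a' b b' : T) :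
  e * a + b - (e' * a' + b') = e * (a - a') + (e - e') * a' + (b - b').
Proof. by ring. Qed.

(** The same induction. At a fold, e A - e' A' = e (A - A') + (e - e') A': the second term,
    estimated by [Nmul_l1_le], is where rho enters. Together with the unfolded branch this gives the
    three summands of [fold_var_fold]. *)
Lemma Nmul_sub_l1_le (rho : R) n l u v p : 0 <= rho ->
  (forall s, s \in Saff D -> `|eta_label q s - eta_label q' s| <= rho) ->
  len v = l -> (folds u (aff_inv v) <= p)%N ->
  l1_le f n (mul (N u) (N v) - mul' (N u) (N v))
    (rho * fold_var M p l * (calN f u + calN f v + 1) ^+ n).
Proof.
move=> rho0 hrho; elim: l u v p => [|l IH] u v p lv fp.
  have luv : len (aff_mul u v) = (len u + len v)%N by rewrite len_mul0// lv addn0.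
  rewrite (hecke_Nmul hq hmul luv) (hecke_Nmul hq' hmul' luv).
  rewrite subrr; apply: (l1_le_trans _ (@l1_le0 _ _ D f n)).
  by rewrite !mulr_ge0 ?wpow_ge0//; case: p {fp} => //= p; rewrite mulr_ge0 ?exprn_ge0 ?(le_trans _ M1).
have [s [a [sS sa va vs [wle wdle lsv]]]] := fold_step u lv.
have var0 k m : 0 <= fold_var M k m.
  by case: k => //= k; rewrite mulr_ge0 ?exprn_ge0 ?(le_trans _ M1).
have fus k : (folds u (aff_inv v) <= k)%N -> (folds (aff_mul u s) (aff_inv (aff_mul s v)) <= k)%N.
  by rewrite vs; apply: leq_trans (folds_wall sa u va).
have [ua|ua] := leP (sep u a) 0.
  rewrite (hecke_straight hq hmul sa ua va) (hecke_straight hq' hmul' sa ua va).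
  apply: (l1_le_trans _ (IH _ _ p lsv (fus _ fp))).
  by apply: ler_pM (wdle n); rewrite ?mulr_ge0 ?var0 ?wpow_ge0// ler_wpM2l// fold_var_S.
have := leq_trans (folds_lt sa ua va) fp; case: p fp => // p fp; rewrite ltnS -vs => fp'.
rewrite (hecke_fold hq hmul sS sa ua va) (hecke_fold hq' hmul' sS sa ua va).
set A := mul (N u) _; set A' := mul' (N u) _; set B := mul _ _; set B' := mul' _ _.
rewrite (_ : _ - _ = hscale (eta_label q s)%:C%C (A - A') +
   hscale (eta_label q s - eta_label q' s)%:C%C A' + (B - B')); last first.
  apply/funext => w; rewrite /hscale.
  rewrite -[LHS]/((eta_label q s)%:C%C * A w + B w - ((eta_label q' s)%:C%C * A' w + B' w)).
  rewrite -[RHS]/((eta_label q s)%:C%C * (A w - A' w) +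
    (eta_label q s - eta_label q' s)%:C%C * A' w + (B w - B' w)).
  rewrite [(_ - eta_label q' s)%:C%C]rmorphB; exact: sub_prod_split.
have b0 := fold_bound_ge0 M1 p l.
apply: (l1_le_trans _ (l1_leD hf (l1_leD hf (l1_leZ _ (IH _ _ p lsv fp'))
  (l1_leZ _ (Nmul_l1_le hq' hmul' hM' n lsv fp'))) (IH _ _ p.+1 lsv (fus _ fp)))).
rewrite !normc_real.
set X := (calN f u + calN f (aff_mul s v) + 1) ^+ n.
set Y := (calN f u + calN f v + 1) ^+ n.
have XY : X <= Y := wle n.
have X0 : 0 <= X by apply: wpow_ge0.
have e1 : `|eta_label q s| * (rho * fold_var M p l * X) <= rho * (M * fold_var M p l) * Y.
  have : `|eta_label q s| * (rho * fold_var M p l) <= rho * (M * fold_var M p l).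
    by rewrite mulrCA; apply/ler_wpM2l/ler_wpM2r/hM.
  have v0 : 0 <= rho * fold_var M p l by rewrite mulr_ge0.
  by move=> h; rewrite [leLHS]mulrA; apply: ler_pM; rewrite ?mulr_ge0.
have e2 : `|eta_label q s - eta_label q' s| * (fold_bound M p l * X) <=
    rho * fold_bound M p l * Y.
  have : `|eta_label q s - eta_label q' s| * fold_bound M p l <= rho * fold_bound M p l.
    exact/ler_wpM2r/hrho.
  move=> h; rewrite [leLHS]mulrA; apply: ler_pM => //; exact: mulr_ge0.
have e3 : rho * fold_var M p.+1 l * (calN f (aff_mul u s) + calN f (aff_mul s v) + 1) ^+ n
    <= rho * fold_var M p.+1 l * Y.
  by apply: ler_wpM2l (wdle n); rewrite mulr_ge0// var0.
apply: le_trans (lerD (lerD e1 e2) e3) _.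
rewrite -!mulrDl -!mulrDr; apply: ler_wpM2r; first exact: wpow_ge0.
apply: ler_wpM2l => //; apply: le_trans (fold_var_fold M1 p l).
by rewrite addrC addrA.
Qed.

End StructureConstants.

(** * The Schwartz algebra *)

Section Pnorm.
Local Open Scope ring_scope.
Local Notation finsupp := Defs.finsupp.
Variables (R : realType) (r : nat) (D : based_root_datum r).
Variables (f : 'cV[R]_r -> R) (hf : is_central_norm D f).
Implicit Types (u v w : affweyl D) (x y : hseries R D) (n : nat).

Local Notation normc := (@Normc.normc R).
Local Notation wt w := (calN f w + 1).

Lemma pnorm_ge n x w : ((normc (x w) * wt w ^+ n)%:E <= pnorm f n x)%E.
Proof. by apply: ereal_sup_ubound; exists w. Qed.

Lemma pnorm_le n x (K : \bar R) :
  (forall w, ((normc (x w) * wt w ^+ n)%:E <= K)%E) -> (pnorm f n x <= K)%E.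
Proof. by move=> H; apply: ge_ereal_sup => _ [w _ <-]. Qed.

Lemma pnorm_ge0 n x : (0 <= pnorm f n x)%E.
Proof.
apply: le_trans (pnorm_ge n x (aff_one D)).
by rewrite lee_fin mulr_ge0 ?normc_ge0 ?exprn_ge0 ?wt_ge0.
Qed.

Lemma pnorm_monotone n m x : (n <= m)%N -> (pnorm f n x <= pnorm f m x)%E.
Proof.
move=> nm; apply: pnorm_le => w; apply: le_trans (pnorm_ge m x w).
by rewrite lee_fin ler_wpM2l ?normc_ge0// ler_weXn2l// wt_ge1.
Qed.

Lemma pnormD n x y : (pnorm f n (x + y)%R <= pnorm f n x + pnorm f n y)%E.
Proof.
apply: pnorm_le => w.
apply: le_trans (leeD (pnorm_ge n x w) (pnorm_ge n y w)).
rewrite -EFinD lee_fin -mulrDl ler_wpM2r ?exprn_ge0 ?wt_ge0//.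
exact: normcD_le.
Qed.

Lemma pnorm0 n : pnorm f n (0 : hseries R D) = 0%E.
Proof.
apply/eqP; rewrite eq_le pnorm_ge0 andbT; apply: pnorm_le => w.
by rewrite [X in normc X]/(0 : R[i]) Normc.normc0 mul0r.
Qed.

Lemma pnorm_eq0 n x : pnorm f n x = 0%E -> x = 0.
Proof.
move=> x0; apply/funext => w; have := pnorm_ge n x w; rewrite x0 lee_fin => xw.
apply: Normc.eq0_normc; apply/eqP; rewrite eq_le normc_ge0 andbT.
have w0 : 0 < wt w ^+ n by rewrite exprn_gt0// (lt_le_trans ltr01) ?wt_ge1.
by rewrite -(pmulr_lle0 _ w0).
Qed.

Lemma pnorm_l1 n x K : l1_le f n x K -> (pnorm f n x <= K%:E)%E.
Proof. by move=> xK; apply: pnorm_le => w; rewrite lee_fin; apply: l1_le_coef. Qed.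

Lemma finsupp_l1 n x : finsupp x -> exists K, l1_le f n x K.
Proof.
move=> /finsupp_sumE[s us ->]; exists (\sum_(u <- s) normc (x u) * wt u ^+ n).
by apply: l1_le_sum => // u; apply/l1_leZ/l1_le_Nbasis.
Qed.

Lemma scvgP (xk : nat -> hseries R D) x : scvg f xk x <->
  forall n (e : R), 0 < e ->
    exists k0, forall k, (k0 <= k)%N -> (pnorm f n (x - xk k)%R <= e%:E)%E.
Proof.
split=> [xkx n e e0|H n].
  have /fine_cvgP[[k1 _ fink] /cvgrPdist_le/(_ e e0)[k2 _ lek]] := xkx n.
  exists (maxn k1 k2) => k; rewrite geq_max => /andP[k1k k2k].
  rewrite -(fineK (fink k k1k)) lee_fin; have := lek k k2k.
  by rewrite /= sub0r normrN; apply: le_trans; apply: ler_norm.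
apply/fine_cvgP; split.
  have [k0 Hk] := H n 1 ltr01; exists k0 => // k /= /Hk h.
  by rewrite ge0_fin_numE ?pnorm_ge0//; apply: le_lt_trans h (ltry _).
apply/cvgrPdist_le => e e0; have [k0 Hk] := H n e e0; exists k0 => // k /= /Hk h.
have fin : pnorm f n (x - xk k) \is a fin_num.
  by rewrite ge0_fin_numE ?pnorm_ge0//; apply: le_lt_trans h (ltry _).
rewrite sub0r normrN ger0_norm ?fine_ge0 ?pnorm_ge0//.
by rewrite -lee_fin fineK.
Qed.

Lemma schwartz_pnorm_fin n x : schwartz f x -> pnorm f n x \is a fin_num.
Proof.
move=> [y [fy /scvgP/(_ n 1 ltr01)[k0 /(_ k0 (leqnn _)) h]]].
rewrite ge0_fin_numE ?pnorm_ge0//.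
have [K yK] := finsupp_l1 n (fy k0).
rewrite -[x](subrK (y k0)); apply: le_lt_trans (pnormD _ _ _) _.
by apply: le_lt_trans (leeD h (pnorm_l1 yK)) _; rewrite -EFinD ltry.
Qed.

Lemma finsupp_schwartz x : finsupp x -> schwartz f x.
Proof.
move=> fx; exists (fun=> x); split=> //; apply/scvgP => n e e0; exists 0%N => k _.
by rewrite subrr pnorm0 lee_fin ltW.
Qed.

(* Truncating x to the supports of finitely supported approximations of x *)
(* does not worsen them.                                                  *)
Lemma schwartz_trunc x : schwartz f x -> exists y : nat -> hseries R D,
  [/\ forall k, finsupp (y k), scvg f y x &
      forall k n K, l1_le f n x K -> l1_le f n (y k) K].
Proof.
move=> [y [fy yx]]; pose t k : hseries R D := fun w => if y k w == 0 then 0 else x w.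
exists t; split.
- move=> k; apply: sub_finite_set (fy k) => w /=.
  by apply: contraNN => /eqP yw; rewrite /t yw eqxx.
- apply/scvgP => n e e0; have [k0 H] := (scvgP _ _).1 yx n e e0.
  exists k0 => k /H; apply: le_trans; apply: pnorm_le => w.
  apply: le_trans (pnorm_ge n _ w); rewrite lee_fin ler_wpM2r ?exprn_ge0 ?wt_ge0//.
  rewrite -[X in normc X <= _]/(x w - t k w) -[X in _ <= normc X]/(x w - y k w) /t.
  by case: eqP => [->//|_]; rewrite subrr Normc.normc0 normc_ge0.
- move=> k n K xK B uB; apply: le_trans (xK B uB); apply: ler_sum => w _.
  rewrite ler_wpM2r ?exprn_ge0 ?wt_ge0// /t; case: eqP => // _.
  by rewrite Normc.normc0 normc_ge0.
Qed.

End Pnorm.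

Section ComplexCauchy.
Local Open Scope ring_scope.
Variable R : realType.
Local Notation normc := (@Normc.normc R).

Lemma real_cauchy (z : nat -> R) :
  (forall e : R, 0 < e -> exists k0, forall j k, (k0 <= j)%N -> (k0 <= k)%N ->
     `|z j - z k| <= e) ->
  exists l : R, forall e : R, 0 < e -> exists k0, forall k, (k0 <= k)%N ->
     `|l - z k| <= e.
Proof.
move=> H; have /cauchy_cvg/cvg_ex[l zl] : cauchy (z @ \oo)%classic.
  apply: cauchy_exP => e e0.
  have [k0 Hk] := H (e / 2) (divr_gt0 e0 (ltr0Sn R 1)).
  exists (z k0); exists k0 => // k /= kk.
  by rewrite -ball_normE /=; apply: le_lt_trans (Hk _ _ (leqnn _) kk) _; lra.
exists l => e e0; have /cvgrPdist_le/(_ e e0)[k0 _ Hk] := zl.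
by exists k0.
Qed.

Lemma complex_cauchy (z : nat -> R[i]) :
  (forall e : R, 0 < e -> exists k0, forall j k, (k0 <= j)%N -> (k0 <= k)%N ->
     normc (z j - z k) <= e) ->
  exists l : R[i], forall e : R, 0 < e -> exists k0, forall k, (k0 <= k)%N ->
     normc (l - z k) <= e.
Proof.
have Re_le (c : R[i]) : `|complex.Re c| <= normc c.
  by case: c => a b /=; rewrite -sqrtr_sqr ler_wsqrtr// lerDl sqr_ge0.
have Im_le (c : R[i]) : `|complex.Im c| <= normc c.
  by case: c => a b /=; rewrite -sqrtr_sqr ler_wsqrtr// lerDr sqr_ge0.
have le_ReIm (c : R[i]) : normc c <= `|complex.Re c| + `|complex.Im c|.
  case: c => a b /=.
  have := normcD_le (a +i* 0)%C (0 +i* b)%C; simpc.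
  by rewrite /= expr0n/= addr0 add0r !sqrtr_sqr.
have ReB (c d : R[i]) : complex.Re (c - d) = complex.Re c - complex.Re d.
  by case: c; case: d.
have ImB (c d : R[i]) : complex.Im (c - d) = complex.Im c - complex.Im d.
  by case: c; case: d.
move=> H; have [|a Ha] := @real_cauchy (fun k => complex.Re (z k)).
  move=> e /H[k0 Hk]; exists k0 => j k kj kk /=.
  by rewrite -ReB; apply: le_trans (Re_le _) (Hk _ _ kj kk).
have [|b Hb] := @real_cauchy (fun k => complex.Im (z k)).
  move=> e /H[k0 Hk]; exists k0 => j k kj kk /=.
  by rewrite -ImB; apply: le_trans (Im_le _) (Hk _ _ kj kk).
exists (a +i* b)%C => e e0.
have [k1 H1] := Ha _ (divr_gt0 e0 (ltr0Sn R 1)).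
have [k2 H2] := Hb _ (divr_gt0 e0 (ltr0Sn R 1)).
exists (maxn k1 k2) => k; rewrite geq_max => /andP[/H1 h1 /H2 h2].
apply: le_trans (le_ReIm _) _; rewrite ReB ImB /=.
by apply: le_trans (lerD h1 h2) _; lra.
Qed.

End ComplexCauchy.

(** * Extension of the product by l^1 continuity *)

Section L1Convergence.
Local Open Scope ring_scope.
Local Notation finsupp := Defs.finsupp.
Variables (R : realType) (r : nat) (D : based_root_datum r).
Variables (f : 'cV[R]_r -> R) (hf : is_central_norm D f).
Implicit Types (u v w : affweyl D) (x y z : hseries R D) (n : nat).

Local Notation normc := (@Normc.normc R).
Local Notation wt w := (calN f w + 1).

Definition l1_cvg (xk : nat -> hseries R D) x := forall n (e : R), 0 < e ->
  exists k0, forall k, (k0 <= k)%N -> l1_le f n (x - xk k) e.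

Lemma l1_leN n x K : l1_le f n x K -> l1_le f n (- x) K.
Proof.
move=> xK B uB; apply: le_trans (xK B uB); apply: ler_sum => w _.
by rewrite [X in normc X]/(- x w) normcN.
Qed.

Lemma l1_leB n x y K L :
  l1_le f n x K -> l1_le f n y L -> l1_le f n (x - y) (K + L).
Proof. by move=> xK yL; apply: l1_leD => //; apply: l1_leN. Qed.

Lemma l1_le_lim (xk : nat -> hseries R D) x n K :
  (forall k, l1_le f n (xk k) K) ->
  (forall e : R, 0 < e -> exists k, l1_le f n (x - xk k) e) -> l1_le f n x K.
Proof.
move=> xkK xkx B uB; apply/ler_addgt0Pl => e /xkx[k xke].
by have := l1_leD hf xke (xkK k); rewrite subrK; apply.
Qed.

Lemma l1_le_all0 n x : (forall e, 0 < e -> l1_le f n x e) -> x = 0.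
Proof.
move=> H; apply: (pnorm_eq0 hf (n := n)); apply/eqP; rewrite eq_le pnorm_ge0// andbT.
by apply/lee_addgt0Pr => e /H /pnorm_l1; rewrite add0e.
Qed.

Lemma l1_cvg_unique xk x x' : l1_cvg xk x -> l1_cvg xk x' -> x = x'.
Proof.
move=> xkx xkx'; apply/eqP; rewrite -subr_eq0; apply/eqP.
apply: (@l1_le_all0 0%N) => e e0.
have [k1 H1] := xkx 0%N _ (divr_gt0 e0 (ltr0Sn R 1)).
have [k2 H2] := xkx' 0%N _ (divr_gt0 e0 (ltr0Sn R 1)).
have := l1_leB (H1 _ (leq_maxl k1 k2)) (H2 _ (leq_maxr k1 k2)).
by rewrite opprB addrA subrK -splitr.
Qed.

Lemma l1_cvgB xk x yk y : l1_cvg xk x -> l1_cvg yk y ->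
  l1_cvg (fun k => xk k - yk k) (x - y).
Proof.
move=> xkx yky n e e0.
have [k1 H1] := xkx n _ (divr_gt0 e0 (ltr0Sn R 1)).
have [k2 H2] := yky n _ (divr_gt0 e0 (ltr0Sn R 1)).
exists (maxn k1 k2) => k; rewrite geq_max => /andP[/H1 h1 /H2 h2].
have := l1_leB h1 h2; rewrite -splitr.
by rewrite opprD addrACA -opprD.
Qed.

Lemma l1_cvg_scvg xk x : l1_cvg xk x -> scvg f xk x.
Proof.
move=> xkx; apply/(scvgP hf) => n e e0; have [k0 H] := xkx n e e0.
by exists k0 => k /H /pnorm_l1.
Qed.

Lemma l1_cvg_bounded xk x n K : l1_cvg xk x -> l1_le f n x K ->
  exists k0, forall k, (k0 <= k)%N -> l1_le f n (xk k) (K + 1).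
Proof.
move=> xkx xK; have [k0 H] := xkx n 1 ltr01; exists k0 => k /H h.
by have := l1_leB xK h; rewrite opprB addrC subrK.
Qed.

(* That is, C_b <= c. *)
Variable c : R.
Hypothesis hc : forall B : seq (affweyl D), uniq B ->
  \sum_(w <- B) wt w ^- const_b r <= c.

Let c_ge0 : 0 <= c.
Proof. by have := hc (B := [::]) isT; rewrite big_nil. Qed.

(** The b extra powers of the weight are exactly what C_b sums. *)
Lemma pnorm_fin_l1 n x (P : R) : (pnorm f (n + const_b r) x <= P%:E)%E ->
  l1_le f n x (c * P).
Proof.
move=> xP B uB; have P0 : 0 <= P by rewrite -lee_fin (le_trans (pnorm_ge0 hf _ _) xP).
rewrite mulrC; apply: le_trans (ler_wpM2l P0 (hc uB)); rewrite mulr_sumr.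
apply: ler_sum => w _; have := le_trans (pnorm_ge f (n + const_b r) x w) xP.
have w0 : 0 < wt w ^+ const_b r by rewrite exprn_gt0// (lt_le_trans ltr01) ?wt_ge1.
by rewrite lee_fin exprD mulrA ler_pdivlMr.
Qed.

Lemma scvg_l1 xk x : scvg f xk x -> l1_cvg xk x.
Proof.
move=> /(scvgP hf) H n e e0.
have [k0 Hk] := H (n + const_b r)%N _ (divr_gt0 e0 (ltr_pwDr ltr01 c_ge0)).
exists k0 => k /Hk /pnorm_fin_l1; apply: l1_le_trans.
rewrite mulrA ler_pdivrMr ?ltr_pwDr//; nra.
Qed.

Lemma schwartz_l1 n x : schwartz f x -> exists K, l1_le f n x K.
Proof.
move=> /(schwartz_pnorm_fin hf (n + const_b r)) xfin.
exists (c * fine (pnorm f (n + const_b r) x)); apply: pnorm_fin_l1.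
by rewrite fineK.
Qed.

Lemma schwartz_l1_approx x : schwartz f x -> exists y : nat -> hseries R D,
  [/\ forall k, finsupp (y k), l1_cvg y x &
      forall k n K, l1_le f n x K -> l1_le f n (y k) K].
Proof. by move=> /(schwartz_trunc hf)[y [fy /scvg_l1 yx yK]]; exists y. Qed.

Lemma schwartzB x y : schwartz f x -> schwartz f y -> schwartz f (x - y).
Proof.
move=> /schwartz_l1_approx[xk [fx xkx _]] /schwartz_l1_approx[yk [fy yky _]].
exists (fun k => xk k - yk k); split=> [k|]; first exact: finsuppB.
exact/l1_cvg_scvg/l1_cvgB.
Qed.

Section Product.
Variables (mul : hseries R D -> hseries R D -> hseries R D) (A : R) (d : nat).
Hypotheses (bil : bilinear_fin mul) (A0 : 0 <= A).
Hypothesis mulfin : forall x y, finsupp x -> finsupp y -> finsupp (mul x y).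
Hypothesis mulA : forall n x y Kx Ky, finsupp x -> finsupp y ->
  l1_le f n x Kx -> l1_le f (n + d) y Ky -> l1_le f n (mul x y) (A * Kx * Ky).

(** Allowing two pairs of approximating sequences yields both the Cauchy property and independence
    of the choice. *)
Lemma mul_l1_close x y xk yk xk' yk' :
  schwartz f x -> schwartz f y ->
  (forall k, finsupp (xk k)) -> (forall k, finsupp (yk k)) ->
  (forall k, finsupp (xk' k)) -> (forall k, finsupp (yk' k)) ->
  l1_cvg xk x -> l1_cvg yk y -> l1_cvg xk' x -> l1_cvg yk' y ->
  forall n (e : R), 0 < e -> exists k0, forall j k, (k0 <= j)%N -> (k0 <= k)%N ->
    l1_le f n (mul (xk j) (yk j) - mul (xk' k) (yk' k)) e.
Proof.
move=> sx sy fx fy fx' fy' xkx yky xkx' yky' n e e0.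
have [Kx xK] := schwartz_l1 n sx; have [Ky yK] := schwartz_l1 (n + d) sy.
have Kx0 := l1_le_ge0 xK; have Ky0 := l1_le_ge0 yK.
(* The two error terms are A (2 E) (Ky + 1) and A (Kx + 1) (2 E), with sum 2 A E (Kx + Ky + 2); A +
   1 replaces A because A may be 0. *)
pose E := e / (2 * (A + 1) * (Kx + Ky + 2)).
have A1 : 0 < A + 1 by rewrite ltr_pwDr.
have K2 : 0 < Kx + Ky + 2 by lra.
have K0 : 0 < 2 * (A + 1) * (Kx + Ky + 2) by rewrite !mulr_gt0.
have E0 : 0 < E by rewrite divr_gt0.
have [k1 H1] := xkx n E E0; have [k2 H2] := xkx' n E E0.
have [k3 H3] := yky (n + d)%N E E0; have [k4 H4] := yky' (n + d)%N E E0.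
have [k5 H5] := l1_cvg_bounded yky yK; have [k6 H6] := l1_cvg_bounded xkx' xK.
exists (maxn (maxn k1 k2) (maxn (maxn k3 k4) (maxn k5 k6))) => j k.
rewrite !geq_max => /andP[/andP[j1 j2] /andP[/andP[j3 j4] /andP[j5 j6]]].
move=> /andP[/andP[l1 l2] /andP[/andP[l3 l4] /andP[l5 l6]]].
have -> : mul (xk j) (yk j) - mul (xk' k) (yk' k) =
    mul (xk j - xk' k) (yk j) + mul (xk' k) (yk j - yk' k).
  by rewrite (opBl bil)// (opBr bil)// addrA subrK.
have hx : l1_le f n (xk j - xk' k) (E + E).
  have := l1_leB (H2 k l2) (H1 j j1).
  by rewrite opprB addrC addrA subrK addrC.
have hy : l1_le f (n + d) (yk j - yk' k) (E + E).
  have := l1_leB (H4 k l4) (H3 j j3).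
  by rewrite opprB addrC addrA subrK addrC.
apply: (l1_le_trans _ (l1_leD hf
  (mulA (finsuppB (fx j) (fx' k)) (fy j) hx (H5 j j5))
  (mulA (fx' k) (finsuppB (fy j) (fy' k)) (H6 k l6) hy))).
have -> : e = E * (2 * (A + 1) * (Kx + Ky + 2)) by rewrite /E divfK ?lt0r_neq0.
rewrite [leLHS](_ : _ = E * (2 * A * (Kx + Ky + 2))); last by ring.
rewrite ler_pM2l// ler_pM2r// ler_pM2l// lerDl//.
Qed.

(** The product of one chosen pair of approximations is l^1-Cauchy. Its coefficientwise limit is an
    l^1 limit, and [mul_l1_close] extends this to every other pair. *)
Lemma schwartz_mul_exists x y : schwartz f x -> schwartz f y ->
  exists z, schwartz f z /\ forall xk yk : nat -> hseries R D,
    (forall k, finsupp (xk k)) -> (forall k, finsupp (yk k)) ->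
    scvg f xk x -> scvg f yk y -> scvg f (fun k => mul (xk k) (yk k)) z.
Proof.
move=> sx sy; have [xk [fx xkx _]] := schwartz_l1_approx sx.
have [yk [fy yky _]] := schwartz_l1_approx sy.
pose zk k := mul (xk k) (yk k).
have zcauchy := mul_l1_close sx sy fx fy fx fy xkx yky xkx yky.
have coefc w : exists l : R[i], forall e : R, 0 < e ->
    exists k0, forall k, (k0 <= k)%N -> normc (l - zk k w) <= e.
  apply: complex_cauchy => e /(zcauchy 0%N)[k0 H]; exists k0 => j k kj kk.
  by have := l1_le_coef w (H j k kj kk); rewrite expr0 mulr1.
pose z : hseries R D := fun w => projT1 (cid (coefc w)).
have zE w : forall e : R, 0 < e -> exists k0, forall k, (k0 <= k)%N ->
    normc (z w - zk k w) <= e by exact: projT2 (cid (coefc w)).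
have zkz : l1_cvg zk z.
  move=> n e e0; have [k0 H] := zcauchy n e e0; exists k0 => k kk B uB.
  apply/ler_addgt0Pl => e' e'0.
  (* On the finite set B coefficientwise convergence suffices, so z may be replaced by zk j with j
     large before the Cauchy bound is used. *)
  have [k1 Hk1] : exists k1, forall j, (k1 <= j)%N ->
      \sum_(w <- B) normc (z w - zk j w) * wt w ^+ n <= e'.
    elim: B {uB} e' e'0 => [|w B IH] e' e'0.
      by exists 0%N => j _; rewrite big_nil ltW.
    have w0 : 0 < wt w ^+ n by rewrite exprn_gt0// (lt_le_trans ltr01) ?wt_ge1.
    have [k1 H1] := IH _ (divr_gt0 e'0 (ltr0Sn R 1)).
    have [k2 H2] := zE w _ (divr_gt0 (divr_gt0 e'0 (ltr0Sn R 1)) w0).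
    exists (maxn k1 k2) => j; rewrite geq_max => /andP[/H1 h1 /H2 h2].
    by rewrite big_cons [leRHS]splitr lerD// -ler_pdivlMr.
  pose j := maxn k0 k1.
  apply: le_trans (lerD (Hk1 j (leq_maxr _ _)) (H j k (leq_maxl _ _) kk B uB)).
  rewrite -big_split/=; apply: ler_sum => w _; rewrite -mulrDl.
  rewrite ler_wpM2r ?exprn_ge0 ?wt_ge0//; apply: le_trans (normcD_le _ _).
  rewrite [X in normc X <= _]/(z w - zk k w) [X in _ <= normc (_ + X)]/(zk j w - zk k w).
  by rewrite addrA subrK.
exists z; split.
  by exists zk; split=> [k|]; [exact: mulfin|exact: l1_cvg_scvg].
move=> xk' yk' fx' fy' /scvg_l1 xkx' /scvg_l1 yky'; apply: l1_cvg_scvg => n e e0.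
have [k1 H1] := zkz n _ (divr_gt0 e0 (ltr0Sn R 1)).
have [k2 H2] := mul_l1_close sx sy fx fy fx' fy' xkx yky xkx' yky' n (divr_gt0 e0 (ltr0Sn R 1)).
exists (maxn k1 k2) => k; rewrite geq_max => /andP[h1 h2].
by have := l1_leD hf (H1 k h1) (H2 k k h2 h2); rewrite addrA subrK -splitr.
Qed.

Lemma schwartz_mulP x y : schwartz f x -> schwartz f y ->
  schwartz f (schwartz_mul f mul x y) /\ forall xk yk : nat -> hseries R D,
    (forall k, finsupp (xk k)) -> (forall k, finsupp (yk k)) ->
    l1_cvg xk x -> l1_cvg yk y ->
    l1_cvg (fun k => mul (xk k) (yk k)) (schwartz_mul f mul x y).
Proof.
move=> sx sy.
have [s H] := xgetPex (0 : hseries R D) (schwartz_mul_exists sx sy).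
by split=> // xk yk fx fy /l1_cvg_scvg hx /l1_cvg_scvg hy; apply/scvg_l1/H.
Qed.

Lemma schwartz_mul_l1 n x y Kx Ky : schwartz f x -> schwartz f y ->
  l1_le f n x Kx -> l1_le f (n + d) y Ky ->
  l1_le f n (schwartz_mul f mul x y) (A * Kx * Ky).
Proof.
move=> sx sy xK yK; have [_ H] := schwartz_mulP sx sy.
have [xk [fx xkx xkK]] := schwartz_l1_approx sx.
have [yk [fy yky ykK]] := schwartz_l1_approx sy.
apply: (@l1_le_lim (fun k => mul (xk k) (yk k))) => [k|e e0].
  by apply: mulA => //; [exact: xkK|exact: ykK].
by have [k0 /(_ k0 (leqnn _))] := H _ _ fx fy xkx yky n e e0; exists k0.
Qed.

Lemma schwartz_mulBl x x' y : schwartz f x -> schwartz f x' -> schwartz f y ->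
  schwartz_mul f mul (x - x') y = schwartz_mul f mul x y - schwartz_mul f mul x' y.
Proof.
move=> sx sx' sy.
have [xk [fx xkx _]] := schwartz_l1_approx sx.
have [xk' [fx' xkx' _]] := schwartz_l1_approx sx'.
have [yk [fy yky _]] := schwartz_l1_approx sy.
have h1 := (schwartz_mulP (schwartzB sx sx') sy).2 _ _
  (fun k => finsuppB (fx k) (fx' k)) fy (l1_cvgB xkx xkx') yky.
have h2 := l1_cvgB ((schwartz_mulP sx sy).2 _ _ fx fy xkx yky)
  ((schwartz_mulP sx' sy).2 _ _ fx' fy xkx' yky).
apply: l1_cvg_unique h1 _.
rewrite (_ : (fun k => _) = fun k => mul (xk k) (yk k) - mul (xk' k) (yk k))//.
by apply/funext => k; rewrite (opBl bil).
Qed.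

End Product.
End L1Convergence.

(** * Estimates for the Schwartz products and their variation with the labels *)

Section HeckeEstimates.
Local Open Scope ring_scope.
Local Notation finsupp := Defs.finsupp.
Variables (R : realType) (r : nat) (D : based_root_datum r).
Variables (f : 'cV[R]_r -> R) (hf : is_central_norm D f).
Implicit Types (q : affweyl D -> R) (x y : hseries R D) (n : nat).
Implicit Types mul : hseries R D -> hseries R D -> hseries R D.

Local Notation d := (size (pos_roots D)).

Variable M : R.
Hypothesis M1 : 1 <= M.
Let M0 : 0 <= M ^+ d. Proof. by rewrite exprn_ge0// (le_trans ler01). Qed.

Lemma hecke_mul_l1 q mul : is_label q -> is_hecke_mul q mul ->
  (forall s, s \in Saff D -> `|eta_label q s| <= M) ->
  forall n x y Kx Ky, finsupp x -> finsupp y ->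
  l1_le f n x Kx -> l1_le f (n + d) y Ky -> l1_le f n (mul x y) (M ^+ d * Kx * Ky).
Proof.
move=> hq hmul hM n x y Kx Ky; apply: bilinear_l1_le => //.
  exact: hecke_bilinear hmul.
move=> u v.
exact: (Nmul_l1_le hf M1 hq hmul hM n (erefl (len v)) (folds_le_pos u (aff_inv v))).
Qed.

Variables (q q' : affweyl D -> R) (mul mul' : hseries R D -> hseries R D -> hseries R D).
Hypotheses (hq : is_label q) (hmul : is_hecke_mul q mul).
Hypotheses (hq' : is_label q') (hmul' : is_hecke_mul q' mul').
Hypothesis hM : forall s, s \in Saff D -> `|eta_label q s| <= M.
Hypothesis hM' : forall s, s \in Saff D -> `|eta_label q' s| <= M.

Lemma rho_ge0 : 0 <= rho q q'.
Proof.
by rewrite /rho; elim/big_ind: _ => // a b a0 b0; rewrite le_max a0.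
Qed.

Lemma rho_ge s : s \in Saff D -> `|eta_label q s - eta_label q' s| <= rho q q'.
Proof. by move=> sS; rewrite /rho; exact: (@le_bigmax_seq _ _ _ _ 0 s xpredT (fun t => `|eta_label q t - eta_label q' t|) sS isT). Qed.

Lemma sub_bilinear : bilinear_fin (fun x y => mul x y - mul' x y).
Proof.
have [b1 b2] := hecke_bilinear hmul; have [b1' b2'] := hecke_bilinear hmul'.
have E (c : R[i]) x x' y y' :
    hscale c x + x' - (hscale c y + y') = hscale c (x - y) + (x' - y').
  apply/funext => w; rewrite -[RHS]/(c * (x w - y w) + (x' w - y' w)).
  by rewrite -[LHS]/(c * x w + x' w - (c * y w + y' w)) mulrBr opprD addrACA.
by split=> c x x' y fx fx' fy; rewrite ?b1 ?b1' ?b2 ?b2'.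
Qed.

Lemma hecke_sub_l1 n x y Kx Ky : finsupp x -> finsupp y ->
  l1_le f n x Kx -> l1_le f (n + d) y Ky ->
  l1_le f n (mul x y - mul' x y) (rho q q' * M ^+ d * Kx * Ky).
Proof.
apply: (bilinear_l1_le sub_bilinear) => //; first by rewrite mulr_ge0 ?rho_ge0.
move=> u v; apply: (l1_le_trans _ (Nmul_sub_l1_le hf M1 hq hmul hq' hmul' hM hM'
  n rho_ge0 rho_ge (erefl (len v)) (folds_le_pos u (aff_inv v)))).
rewrite ler_wpM2r//; first by rewrite exprn_ge0// -addrA addr_ge0 ?calN_ge0// wt_ge0.
by rewrite -mulrA ler_wpM2l ?rho_ge0// fold_var_le_bound.
Qed.

(** Serves the case of infinite C_b, where rho = 0 makes the bound of the difference vanish. The two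
    products already agree on finitely supported series. *)
Lemma schwartz_mul_eq : rho q q' = 0 -> schwartz_mul f mul = schwartz_mul f mul'.
Proof.
move=> rho0.
have E x y : finsupp x -> finsupp y -> mul x y = mul' x y.
  move=> fx fy; apply/eqP; rewrite -subr_eq0; apply/eqP.
  have [Kx xK] := finsupp_l1 hf 0 fx; have [Ky yK] := finsupp_l1 hf (0 + d) fy.
  have := hecke_sub_l1 fx fy xK yK; rewrite rho0 !mul0r => h.
  by apply: (l1_le_all0 hf (n := 0)) => e e0; apply: l1_le_trans (ltW e0) h.
apply/funext => x; apply/funext => y; rewrite /schwartz_mul; congr (xget _ _).
apply/seteqP; split=> z [sz H]; split=> // xk yk fx fy xkx yky.
  rewrite (_ : (fun k => _) = fun k => mul (xk k) (yk k)); first exact: H.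
  by apply/funext => k; rewrite E.
rewrite (_ : (fun k => _) = fun k => mul' (xk k) (yk k)); first exact: H.
by apply/funext => k; rewrite E.
Qed.

Lemma fold_sub_arith (t a b e k : R) :
  t * (a * b * (e + k)) = a * (t * e) * b + t * a * k * b.
Proof. by ring. Qed.

Section FiniteCb.
Variable c : R.
Hypothesis hc : forall B : seq (affweyl D), uniq B ->
  \sum_(w <- B) (calN f w + 1) ^- const_b r <= c.

Local Notation sm := (schwartz_mul f mul).
Local Notation sm' := (schwartz_mul f mul').

Let bil := hecke_bilinear hmul.
Let bil' := hecke_bilinear hmul'.
Let fin := hecke_fin hmul.
Let fin' := hecke_fin hmul'.
Let bnd := hecke_mul_l1 hq hmul hM.
Let bnd' := hecke_mul_l1 hq' hmul' hM'.
Let smP := schwartz_mulP hf hc bil M0 fin bnd.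
Let smP' := schwartz_mulP hf hc bil' M0 fin' bnd'.
Let sm_l1 := schwartz_mul_l1 hf hc bil M0 fin bnd.
Let sm_l1' := schwartz_mul_l1 hf hc bil' M0 fin' bnd'.

Lemma schwartz_mul_sub_l1 n x y Kx Ky : schwartz f x -> schwartz f y ->
  l1_le f n x Kx -> l1_le f (n + d) y Ky ->
  l1_le f n (sm x y - sm' x y) (rho q q' * M ^+ d * Kx * Ky).
Proof.
move=> sx sy xK yK.
have [xk [fx xkx xkK]] := schwartz_l1_approx hf hc sx.
have [yk [fy yky ykK]] := schwartz_l1_approx hf hc sy.
apply: (@l1_le_lim _ _ _ _ hf (fun k => mul (xk k) (yk k) - mul' (xk k) (yk k))) => [k|e e0].
  by apply: hecke_sub_l1 => //; [exact: xkK|exact: ykK].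
have := l1_cvgB hf ((smP sx sy).2 _ _ fx fy xkx yky) ((smP' sx sy).2 _ _ fx fy xkx yky).
by move=> /(_ n e e0)[k0 /(_ k0 (leqnn _))]; exists k0.
Qed.

Variables (I : Type) (y : I -> hseries R D) (n : nat) (K : I -> R).
Hypotheses (sy : forall i, schwartz f (y i)) (yK : forall i, l1_le f (n + d) (y i) (K i)).

(** The accumulated left factor stays at weight n throughout; each new right factor is measured at
    weight n + d. *)
Lemma foldl_schwartz_mul x (s : seq I) K0 : schwartz f x -> l1_le f n x K0 ->
  l1_le f n (foldl sm x [seq y i | i <- s]) (K0 * \prod_(i <- s) (M ^+ d * K i)).
Proof.
elim: s x K0 => [|i s IH] x K0 sx xK /=; first by rewrite big_nil mulr1.
rewrite big_cons mulrA; apply: IH; first by have [] := smP sx (sy i).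
by rewrite mulrA [K0 * _]mulrC; apply: sm_l1.
Qed.

(** Telescoping: the new error is (x - x') y plus the change of product at x' y. Here e0 is the
    current error in units of rho and K0 the size of x'. *)
Lemma foldl_schwartz_mul_sub x x' (s : seq I) e0 K0 :
  schwartz f x -> schwartz f x' -> l1_le f n x' K0 ->
  l1_le f n (x - x') (rho q q' * e0) -> 0 <= e0 ->
  l1_le f n (foldl sm x [seq y i | i <- s] - foldl sm' x' [seq y i | i <- s])
    (rho q q' * (e0 + K0) * \prod_(i <- s) (2 * (M ^+ d * K i))).
Proof.
elim: s x x' e0 K0 => [|i s IH] x x' e0 K0 sx sx' xK xx' e00 /=.
  rewrite big_nil mulr1; apply: (l1_le_trans _ xx').
  by rewrite ler_wpM2l ?rho_ge0// lerDl (l1_le_ge0 xK).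
have Ki0 := l1_le_ge0 (yK i); have K00 := l1_le_ge0 xK.
have h1 := sm_l1 (schwartzB hf hc sx sx') (sy i) xx' (yK i).
rewrite (schwartz_mulBl hf hc bil M0 fin bnd)// in h1.
have h2 := schwartz_mul_sub_l1 sx' (sy i) xK (yK i).
have h3 := l1_leD hf h1 h2; rewrite addrA subrK in h3.
(* With T = M^d K_i the new error and size are T (e0 + K0) and T K0; their sum is at most 2 T (e0 +
   K0), whence the factor 2 per step. *)
apply: (l1_le_trans _ (IH _ _ (M ^+ d * K i * (e0 + K0)) (M ^+ d * K0 * K i) _ _ _ _ _)).
- rewrite big_cons [leRHS]mulrA ler_wpM2r//.
    by apply: prodr_ge0 => j _; rewrite !mulr_ge0// (l1_le_ge0 (yK j)).
  rewrite -[leRHS]mulrA ler_wpM2l ?rho_ge0//.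
  have : 0 <= M ^+ d * K i by rewrite mulr_ge0.
  rewrite [_ * K0 * K i]mulrAC; move: (M ^+ d * K i) => T T0; nra.
- by have [] := smP sx (sy i).
- by have [] := smP' sx' (sy i).
- exact: sm_l1'.
- by rewrite fold_sub_arith.
- by rewrite !mulr_ge0// addr_ge0.
Qed.

End FiniteCb.
End HeckeEstimates.

(** * From l^1 norms back to the seminorms *)

Section Final.
Local Open Scope ring_scope.
Local Notation finsupp := Defs.finsupp.
Variables (R : realType) (r : nat) (D : based_root_datum r).
Variables (f : 'cV[R]_r -> R) (hf : is_central_norm D f).
Implicit Types (q : affweyl D -> R) (x y : hseries R D).
Implicit Types mul : hseries R D -> hseries R D -> hseries R D.

Local Notation d := (size (pos_roots D)).

Lemma max1_expn (eta : R) k : 0 < eta -> Num.max 1 eta ^+ k = Num.max 1 (eta ^+ k).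
Proof.
move=> eta0; have [le1|lt1] := leP eta 1.
  by rewrite expr1n; apply/esym/max_idPl/exprn_ile1 => //; apply: ltW.
by apply/esym/max_idPr/exprn_ege1/ltW.
Qed.

Lemma eta_label_ball eta q s : rho_ball (@label0 R r D) eta q -> s \in Saff D ->
  `|eta_label q s| <= Num.max 1 eta.
Proof.
move=> [_ qeta] sS; have := rho_ge (@label0 R r D) q sS.
rewrite {1}/eta_label /label0 sqrtr1 invr1 subrr sub0r normrN => h.
by rewrite le_max (ltW (le_lt_trans h qeta)) orbT.
Qed.

Lemma const_Cb_finite (c : R) (B : seq (affweyl D)) : const_Cb D f = c%:E -> uniq B ->
  \sum_(w <- B) (calN f w + 1) ^- const_b r <= c.
Proof.
move=> cE uB; rewrite -lee_fin -cE; apply: esum_ge; exists [set` B]%classic.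
  by split=> //; exact: finite_seq.
by rewrite -sumEFin fsbig_seq.
Qed.

(** The identity of W contributes 1. *)
Lemma const_Cb_ge1 (c : R) : const_Cb D f = c%:E -> 1 <= c.
Proof.
move=> cE; have := const_Cb_finite (B := [:: aff_one D]) cE isT.
by rewrite big_seq1 calN1// add0r expr1n invr1.
Qed.

Lemma schwartz0 : schwartz f (0 : hseries R D).
Proof. exact/(finsupp_schwartz hf)/finsupp_zero. Qed.

(** Without finiteness of C_b the limit may be missing, but the default 0 of [xget] is Schwartz
    too. *)
Lemma schwartz_mul_schwartz mul x y : schwartz f (schwartz_mul f mul x y).
Proof. by rewrite /schwartz_mul; case: xgetP => [z _ []//|_]; apply: schwartz0. Qed.

Section Zero.
Variables (q : affweyl D -> R) (mul : hseries R D -> hseries R D -> hseries R D).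
Hypothesis hmul : is_hecke_mul q mul.
Let bil := hecke_bilinear hmul.

Let scvg0 (z : hseries R D) : scvg f (fun=> 0 : hseries R D) z -> z = 0.
Proof.
move=> /(scvgP hf) H; apply: (pnorm_eq0 hf (n := 0)).
apply/eqP; rewrite eq_le pnorm_ge0// andbT; apply/lee_addgt0Pr => e /(H 0%N)[k0 h].
by rewrite add0e; have := h k0 (leqnn _); rewrite subr0.
Qed.

Let cst0 : scvg f (fun=> 0) (0 : hseries R D).
Proof.
apply/(scvgP hf) => n e e0; exists 0%N => k _.
by rewrite subr0 pnorm0// lee_fin ltW.
Qed.

Lemma schwartz_mul0l y : schwartz f y -> schwartz_mul f mul 0 y = 0.
Proof.
move=> [yk [fy yky]]; rewrite /schwartz_mul; case: xgetP => // z _ [_ H].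
apply: scvg0; have := H (fun=> 0) yk (fun=> @finsupp_zero R r D) fy cst0 yky.
by rewrite (_ : (fun k => _) = fun=> 0)//; apply/funext => k; rewrite (op0l bil).
Qed.

Lemma schwartz_mul0r x : schwartz f x -> schwartz_mul f mul x 0 = 0.
Proof.
move=> [xk [fx xkx]]; rewrite /schwartz_mul; case: xgetP => // z _ [_ H].
apply: scvg0; have := H xk (fun=> 0) fx (fun=> @finsupp_zero R r D) xkx cst0.
by rewrite (_ : (fun k => _) = fun=> 0)//; apply/funext => k; rewrite (op0r bil).
Qed.

(** Since oo * 0 = 0 in the extended reals, a zero factor can make the bound vanish even for
    infinite C_b; the product must then be 0. *)
Lemma schwartz_prod_eq0 m (x : 'I_m.+1 -> hseries R D) i :
  (forall j, schwartz f (x j)) -> x i = 0 -> schwartz_prod f mul x = 0.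
Proof.
move=> sx xi; rewrite /schwartz_prod.
have fold0 (s : seq 'I_m) : foldl (schwartz_mul f mul) 0 [seq x (lift ord0 j) | j <- s] = 0.
  by elim: s => //= j s IH; rewrite schwartz_mul0l.
have [j ij|i0] := unliftP ord0 i; last by move: xi; rewrite i0 => ->; exact: fold0.
have : j \in enum 'I_m by rewrite mem_enum.
have := sx ord0; move: (x ord0) (enum 'I_m) => y s.
elim: s y => //= k s IH y sy; rewrite in_cons => /predU1P[jk|].
  by rewrite -jk -ij xi (schwartz_mul0r sy) fold0.
exact/IH/schwartz_mul_schwartz.
Qed.

End Zero.

Section Estimate.
Variables (eta : R) (n : nat) (q q' : affweyl D -> R).
Variables (mul mul' : hseries R D -> hseries R D -> hseries R D).
Hypothesis eta0 : 0 < eta.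
Hypotheses (qB : rho_ball (@label0 R r D) eta q) (qB' : rho_ball (@label0 R r D) eta q').
Hypotheses (hmul : is_hecke_mul q mul) (hmul' : is_hecke_mul q' mul').
Variables (m : nat) (x : 'I_m.+1 -> hseries R D).
Hypothesis sx : forall i, schwartz f (x i).

Let M := Num.max 1 eta.
Let M1 : 1 <= M. Proof. by rewrite le_max lexx. Qed.
Let hq : is_label q. Proof. by case: qB. Qed.
Let hq' : is_label q'. Proof. by case: qB'. Qed.
Let hM s : s \in Saff D -> `|eta_label q s| <= M.
Proof. exact: eta_label_ball. Qed.
Let hM' s : s \in Saff D -> `|eta_label q' s| <= M.
Proof. exact: eta_label_ball. Qed.

Let factor i := (const_Ceta D f eta * const_Cb D f * pnorm f (n + const_b' D) (x i))%E.

Lemma estimate_finite (c : R) : const_Cb D f = c%:E ->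
  (pnorm f n (schwartz_prod f mul x) <= \prod_(i < m.+1) factor i)%E /\
  (pnorm f n (schwartz_prod f mul x - schwartz_prod f mul' x)%R <=
     (rho q q')%:E * \prod_(i < m.+1) factor i)%E.
Proof.
move=> cE; have hc B := @const_Cb_finite c B cE; have c1 := const_Cb_ge1 cE.
pose P i := fine (pnorm f (n + const_b' D) (x i)).
have PE i : pnorm f (n + const_b' D) (x i) = (P i)%:E by rewrite fineK// schwartz_pnorm_fin.
have P0 i : 0 <= P i by rewrite fine_ge0 ?pnorm_ge0.
(* The index n + b' has room for the b powers lost in passing to l^1 norms and for the |R_0^+| lost
   by a right factor. *)
have l1x k i : (k + const_b r <= n + const_b' D)%N -> l1_le f k (x i) (c * P i).
  move=> kn; apply: (pnorm_fin_l1 hf hc); rewrite -PE; exact: pnorm_monotone.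
have xn i : l1_le f n (x i) (c * P i) by apply: l1x; rewrite /const_b'; lia.
have xnd i : l1_le f (n + d) (x i) (c * P i) by apply: l1x; rewrite /const_b'; lia.
pose A := M ^+ d.
have A1 : 1 <= A by rewrite exprn_ege1.
have factorE i : factor i = (3 * c * A * c * P i)%:E.
  by rewrite /factor /const_Ceta cE PE -max1_expn// -!EFinM.
have -> : (\prod_(i < m.+1) factor i = (\prod_(i < m.+1) (3 * c * A * c * P i))%:E)%E.
  by rewrite -prodEFin; apply: eq_bigr.
have cP i : 0 <= c * P i by rewrite mulr_ge0// (le_trans ler01).
(* The factor 3 C_b in C_eta absorbs the 2 of each telescoping step, as C_b >= 1. *)
have le2 i : 2 * (A * (c * P i)) <= 3 * c * A * c * P i.
  rewrite -[leRHS]mulrA !mulrA -[leLHS]mulrA -[leRHS]mulrA ler_wpM2r//; nra.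
have le1 i : c * P i <= 3 * c * A * c * P i.
  by apply: le_trans (le2 i); move: (c * P i) (cP i) => T T0; nra.
have leA i : A * (c * P i) <= 3 * c * A * c * P i.
  by apply: le_trans (le2 i); move: (c * P i) (cP i) => T T0; nra.
pose s := enum 'I_m; pose y i := x (lift ord0 i).
have prodE (F : 'I_m -> R) : \prod_(i <- s) F i = \prod_(i < m) F i.
  by rewrite big_enum.
split.
  have h := foldl_schwartz_mul hf M1 hq hmul hM hc (fun i => sx (lift ord0 i))
    (fun i => xnd (lift ord0 i)) s (sx ord0) (xn ord0).
  apply: le_trans (pnorm_l1 h) _; rewrite lee_fin big_ord_recl prodE.
  apply: ler_pM => //; first by apply: prodr_ge0 => i _; rewrite mulr_ge0// (le_trans ler01).
  by apply: ler_prod => i _; rewrite leA andbT mulr_ge0// (le_trans ler01).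
have xx : l1_le f n (x ord0 - x ord0) (rho q q' * 0).
  by rewrite subrr mulr0; apply: l1_le0.
have h := foldl_schwartz_mul_sub hf M1 hq hmul hq' hmul' hM hM' hc (fun i => sx (lift ord0 i))
  (fun i => xnd (lift ord0 i)) s (sx ord0) (sx ord0) (xn ord0) xx (lexx 0).
apply: le_trans (pnorm_l1 h) _; rewrite -EFinM lee_fin add0r -mulrA.
apply: ler_wpM2l; first exact: rho_ge0.
rewrite big_ord_recl prodE; apply: ler_pM => //.
  by apply: prodr_ge0 => i _; rewrite !mulr_ge0// (le_trans ler01).
by apply: ler_prod => i _; rewrite le2 andbT !mulr_ge0// (le_trans ler01).
Qed.

(* The right-hand sides are then infinite, except when some [x i] or        *)
(* [rho q q'] is 0, and then the left-hand sides vanish as well.            *)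
Lemma estimate_infinite : const_Cb D f = +oo%E ->
  (pnorm f n (schwartz_prod f mul x) <= \prod_(i < m.+1) factor i)%E /\
  (pnorm f n (schwartz_prod f mul x - schwartz_prod f mul' x)%R <=
     (rho q q')%:E * \prod_(i < m.+1) factor i)%E.
Proof.
move=> Cinf.
have CetaE : const_Ceta D f eta = +oo%E.
  rewrite /const_Ceta Cinf gt0_muley ?lte_fin//.
  by rewrite gt0_mulye// lte_fin lt_max ltr01.
have factor_ge0 i : (0 <= factor i)%E.
  by rewrite /factor CetaE Cinf mule_ge0 ?pnorm_ge0 ?mule_ge0 ?leey.
have prod_ge0 : (0 <= \prod_(i < m.+1) factor i)%E by apply: prode_ge0.
have [[i xi]|xneq0] := pselect (exists i, x i = 0).
  rewrite (schwartz_prod_eq0 hmul sx xi) (schwartz_prod_eq0 hmul' sx xi) subrr pnorm0//.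
  by split=> //; rewrite mule_ge0 ?lee_fin ?rho_ge0.
have factorE i : factor i = +oo%E.
  rewrite /factor CetaE Cinf mulyy gt0_mulye// lt_neqAle pnorm_ge0// andbT eq_sym.
  by apply/eqP => /(pnorm_eq0 hf) xi; apply: xneq0; exists i.
have prodE : (\prod_(i < m.+1) factor i = +oo)%E.
  rewrite (eq_bigr (fun=> +oo%E)) => [|i _]; last exact: factorE.
  suff H k : (\prod_(i < k.+1) +oo = +oo :> \bar R)%E by exact: H.
  by elim: k => [|k IH]; rewrite ?big_ord1// big_ord_recl IH mulyy.
rewrite prodE; split; first exact: leey.
have [rho0|rho_neq0] := eqVneq (rho q q') 0.
  rewrite rho0 mul0e /schwartz_prod (schwartz_mul_eq hf M1 hq hmul hq' hmul' hM hM' rho0).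
  by rewrite subrr pnorm0.
by rewrite gt0_muley ?leey// lte_fin lt_neqAle eq_sym rho_neq0 rho_ge0.
Qed.

End Estimate.
End Final.

Theorem proposition5p7 (R : realType) (r : nat) (D : based_root_datum r)
    (f : 'cV[R]_r -> R) (hf : is_central_norm D f)
    (eta : R) (heta : (0 < eta)%R) (n : nat) (q q' : affweyl D -> R)
    (hq : rho_ball (@label0 R r D) eta q)
    (hq' : rho_ball (@label0 R r D) eta q')
    (mul mul' : hseries R D -> hseries R D -> hseries R D)
    (hmul : is_hecke_mul q mul) (hmul' : is_hecke_mul q' mul')
    (m : nat) (x : 'I_m.+1 -> hseries R D)
    (hx : forall i, schwartz f (x i)) :
  (pnorm f n (schwartz_prod f mul x) <=
     \prod_(i < m.+1) (const_Ceta D f eta * const_Cb D f *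
                       pnorm f (n + const_b' D) (x i)))%E /\
  (pnorm f n (schwartz_prod f mul x - schwartz_prod f mul' x)%R <=
     (rho q q')%:E *
     \prod_(i < m.+1) (const_Ceta D f eta * const_Cb D f *
                       pnorm f (n + const_b' D) (x i)))%E.
Proof.
have Cge0 : (0 <= const_Cb D f)%E.
  by apply: esum_ge0 => w _; rewrite lee_fin invr_ge0 exprn_ge0// wt_ge0.
case CE : (const_Cb D f) Cge0 => [c| |] // _; rewrite -CE.
  exact: (estimate_finite hf n heta hq hq' hmul hmul' hx CE).
exact: (estimate_infinite hf n hq hq' hmul hmul' hx CE).
Qed.
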